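(* Let $X$ be an infinite dimensional Banach space with an unconditional basis and finite cotype. Then there exists a map $\ell_2\to X$ which is simultaneously a coarse embedding and a uniform embedding.
   Context: For a map $f:(M,d)\to(N,\partial)$ between metric spaces and $t\ge 0$, let $\omega_f(t)=\sup\{\partial(f(x),f(y)) : d(x,y)\le t\}$ and $\rho_f(t)=\inf\{\partial(f(x),f(y)) : d(x,y)\ge t\}$ (with $\inf\emptyset=\infty$). $f$ is coarse if $\omega_f(t)<\infty$ for all $t\ge 0$; expanding if $\lim_{t\to\infty}\rho_f(t)=\infty$; a coarse embedding if it is both coarse and expanding; a uniform embedding if $\lim_{t\to 0^+}\omega_f(t)=0$ and $\rho_f(t)>0$ for all $t>0$. Banach spaces carry their norm metrics. *)

(* Defs.v *)
From HB Require Import structures.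
From mathcomp Require Import all_boot all_order all_algebra.
From mathcomp Require Import all_classical all_reals all_analysis.

Set Implicit Arguments.
Unset Strict Implicit.
Unset Printing Implicit Defensive.

Import Order.TTheory GRing.Theory Num.Theory.
Import numFieldNormedType.Exports.

Local Open Scope classical_set_scope.
Local Open Scope ring_scope.

(* Moduli of a map between normed spaces, for the norm metrics. The values are
   extended reals, so that rho f t = +oo when no two points are at distance
   at least t. *)
Section moduli.
Context {R : realType} {V W : normedModType R}.
Implicit Types (f : V -> W) (t : R).

Definition omega f t : \bar R :=
  ereal_sup [set `|f xy.1 - f xy.2|%:E |
              xy in [set xy : V * V | `|xy.1 - xy.2| <= t]].

Definition rho f t : \bar R :=
  ereal_inf [set `|f xy.1 - f xy.2|%:E |
              xy in [set xy : V * V | `|xy.1 - xy.2| >= t]].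

Definition coarse f : Prop := forall t, 0 <= t -> (omega f t < +oo)%E.

Definition expanding f : Prop := rho f t @[t --> +oo%R] --> +oo%E.

Definition coarse_embedding f : Prop := coarse f /\ expanding f.

Definition uniform_embedding f : Prop :=
  omega f t @[t --> 0^'+] --> 0%E /\ forall t, 0 < t -> (0 < rho f t)%E.

End moduli.

Section banach_notions.
Context {R : realType}.

Definition finite_dimensional (V : lmodType R) : Prop :=
  exists (n : nat) (v : 'I_n -> V),
    forall x : V, exists c : 'I_n -> R, x = \sum_(i < n) c i *: v i.

Context (X : normedModType R).

Definition schauder_basis (e : X^nat) : Prop :=
  forall x : X, exists! a : R^nat, series (fun n => a n *: e n) @ \oo --> x.

Definition unconditionally_convergent (u : X^nat) : Prop :=
  forall s : nat -> nat, bijective s -> cvgn (series (u \o s)).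

Definition unconditional_basis (e : X^nat) : Prop :=
  schauder_basis e /\
  forall (a : R^nat) (x : X), series (fun n => a n *: e n) @ \oo --> x ->
    unconditionally_convergent (fun n => a n *: e n).

(* E || \sum_i eps_i x_i ||^q for independent uniform signs eps_i. *)
Definition rademacher_moment (q : R) (n : nat) (x : 'I_n -> X) : R :=
  (\sum_(eps : {ffun 'I_n -> bool})
     `| \sum_(i < n) (-1) ^+ eps i *: x i | `^ q) / 2 ^+ n.

Definition has_cotype (q : R) : Prop :=
  exists2 C : R, 0 < C & forall (n : nat) (x : 'I_n -> X),
    (\sum_(i < n) `|x i| `^ q) `^ q^-1 <= C * rademacher_moment q x `^ q^-1.

Definition finite_cotype : Prop := exists2 q : R, 2 <= q & has_cotype q.

End banach_notions.

(* The library's L^2 functions for the counting measure on nat form an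
   lmodType without a norm. The alias ell2 carries the norm; since only the
   empty set is null, no quotient is needed. *)
Definition ell2 (R : realType) : Type :=
  LfunType (@counting nat R) (lee1n 2 : (1 <= 2%:R%:E :> \bar R)%E).

Section ell2_norm.
Context {R : realType}.

HB.instance Definition _ := GRing.Lmodule.on (ell2 R).

Definition ell2_norm (x : ell2 R) : R :=
  fine (Lnorm (@counting nat R) 2%:R%:E (EFin \o x)).

Let ell2_ler_normD (x y : ell2 R) :
  ell2_norm (x + y) <= ell2_norm x + ell2_norm y.
Proof. exact: ler_LnormD. Qed.

Let ell2_normrZ (l : R) (x : ell2 R) : ell2_norm (l *: x) = `|l| * ell2_norm x.
Proof.
by apply: EFin_inj; rewrite EFinM !finite_norm_fine; exact: LnormZ.
Qed.

Lemma ell2_normE (x : ell2 R) :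
  (ell2_norm x)%:E = ((\sum_(k <oo) (x k ^+ 2)%:E) `^ 2^-1)%E.
Proof.
rewrite finite_norm_fine Lnorm_counting//; congr (_ `^ _)%E.
by apply: eq_eseriesr => k _ /=; rewrite powR_mulrn// real_normK// num_real.
Qed.

Let ell2_normr0_eq0 (x : ell2 R) : ell2_norm x = 0 -> x = 0.
Proof.
move=> x0; apply/LfuneqP => k; apply/eqP; rewrite -sqrf_eq0.
move: (ell2_normE x); rewrite x0 => /esym /poweR_eq0_eq0 sum0.
have {}sum0 : (\sum_(k <oo) (x k ^+ 2)%:E = 0)%E.
  by apply: sum0; apply: nneseries_ge0 => n _ _; rewrite lee_fin sqr_ge0.
have := @nneseries_lim_ge R (fun n => (x n ^+ 2)%:E) xpredT 0%N k.+1.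
rewrite sum0 big_nat_recr//= => /(_ (fun n _ _ => sqr_ge0 (x n))) le0.
rewrite eq_le sqr_ge0 andbT -lee_fin (le_trans _ le0)// leeDr//.
by apply: sume_ge0 => n _; exact: sqr_ge0.
Qed.

HB.instance Definition _ := Lmodule_isNormed.Build R (ell2 R)
  ell2_ler_normD ell2_normrZ ell2_normr0_eq0.

End ell2_norm.

(* Main.v *)
Require Import Defs.
From mathcomp Require Import all_boot all_order all_algebra.
From mathcomp Require Import all_classical all_reals all_analysis.
From mathcomp Require Import ring lra.
Import numFieldNormedType.Exports.

(** A sequence space with an unconditional basis and finite cotype satisfies a
    lower [q]-estimate, and can be renormed so that the [q]-th power [Psi] of
    the norm is superadditive on disjoint vectors. Following Lozanovskii and
    Odell-Schlumprecht, send a probability [h] on [nat] to an (approximate)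
    maximiser [y] of [sum_i h_i ln y_i] on the positive unit ball of [Psi].
    Testing against midpoints shows that [y] and [y'] have almost everywhere
    ratio close to 1 when [h] is close to [h'] in l1; testing against
    [y + y 1_{~A}] shows that [y] is small on [A] when [h(A)] is, by
    superadditivity. Hence [h |-> y] is uniformly continuous and separates
    nearly disjoint probabilities; no uniform convexity or smoothness is needed.

    Nearly disjoint probabilities come from Poisson measures (squared
    exponential vectors of Fock space): for [x] in l2 with nonnegative
    coordinates, the Hellinger affinity of the measures of [x] and [y] is
    [exp (- |x - y|^2 / 2)]. This gives a bounded, uniformly continuous map of
    l2 into the span of any infinite part of the basis which separates distant
    points. Cut the basis into infinitely many infinite blocks and add such
    maps, rescaled: with small amplitudes and finer and finer scales on half of
    the blocks (uniform embedding), with large amplitudes and coarser and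
    coarser scales on the other half (coarse embedding). Unconditionality makes
    each block component a lower bound for the sum. *)

Set Implicit Arguments.
Unset Strict Implicit.
Unset Printing Implicit Defensive.

Import Order.TTheory GRing.Theory Num.Theory.

Local Open Scope classical_set_scope.
Local Open Scope ring_scope.

(** * Renorming for a lower estimate *)

Lemma powR_midpoint (R : realType) (q a b : R) : 1 <= q -> 0 <= a -> 0 <= b ->
  ((a + b) / 2) `^ q <= (a `^ q + b `^ q) / 2.
Proof.
move=> q1 a0 b0.
have e (x y : R) : (x + y) / 2 = 2^-1 * x + (1 - 2^-1) * y by field.
rewrite !e; apply: (convex_powR q1 (Itv01 _ _)) => //=;
  by rewrite ?inE/= ?in_itv/= ?andbT// ?invr_ge0// ?invf_le1 ?ler1n.
Qed.

Section lattice_modulus.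
Context {R : realType} {X : normedModType R}.
Variables (u : nat -> X) (q : R) (D : R).
Implicit Types (c a b h y z : nat -> R) (k n : nat) (A : pred nat).

(* The colouring [p.2] uses the colours below [p.1]; the indices of any other
   colour are dropped. *)
Definition coloring_sum (n : nat) (c : nat -> R) (p : nat * (nat -> nat)) : R :=
  \sum_(j < p.1) `|\sum_(i < n | p.2 i == j) c i *: u i| `^ q.

Definition lower_estimate : Prop :=
  forall n (c : nat -> R) p, coloring_sum n c p <= D * `|\sum_(i < n) c i *: u i| `^ q.

(** Under [lower_estimate] this agrees with the [q]-th power of the norm up to the factor [D].
    Passing to the supremum makes the lower estimate hold with constant 1, in the form of
    superadditivity. *)
Definition Psi (n : nat) (c : nat -> R) : R := sup (range (coloring_sum n c)).

Hypothesis q1 : 1 <= q.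
Hypothesis lowD : lower_estimate.

Let q0 : 0 < q. Proof. exact: lt_le_trans q1. Qed.
Let q0' : 0 <= q. Proof. exact: ltW. Qed.

Lemma eq_coloring_sum n c c' p : (forall i, (i < n)%N -> c i = c' i) ->
  coloring_sum n c p = coloring_sum n c' p.
Proof.
move=> cc'; apply: eq_bigr => j _; congr (`|_| `^ q).
by apply: eq_bigr => i _; rewrite cc'.
Qed.

Lemma eq_Psi n c c' : (forall i, (i < n)%N -> c i = c' i) -> Psi n c = Psi n c'.
Proof.
move=> cc'; rewrite /Psi (_ : coloring_sum n c = coloring_sum n c')//.
by apply/funext => p; exact: eq_coloring_sum.
Qed.

Lemma has_sup_Psi n c : has_sup (range (coloring_sum n c)).
Proof.
split; first by exists (coloring_sum n c (0%N, id)); exists (0%N, id).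
by exists (D * `|\sum_(i < n) c i *: u i| `^ q) => _ [p _ <-]; exact: lowD.
Qed.

Lemma Psi_ub n c p : coloring_sum n c p <= Psi n c.
Proof. by apply: ub_le_sup; [case: (has_sup_Psi n c)|exists p]. Qed.

Lemma Psi_le n c B : (forall p, coloring_sum n c p <= B) -> Psi n c <= B.
Proof.
move=> cB; apply: ge_sup; first by case: (has_sup_Psi n c).
by move=> _ [p _ <-].
Qed.

Lemma Psi_le_norm n c : Psi n c <= D * `|\sum_(i < n) c i *: u i| `^ q.
Proof. by apply: Psi_le => p; exact: lowD. Qed.

Lemma norm_le_Psi n c : `|\sum_(i < n) c i *: u i| `^ q <= Psi n c.
Proof. by have := Psi_ub n c (1%N, fun=> 0%N); rewrite /coloring_sum big_ord1. Qed.

Lemma Psi_ge0 n c : 0 <= Psi n c.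
Proof. by apply: le_trans (norm_le_Psi n c); exact: powR_ge0. Qed.

Lemma coord_le_Psi n c i : (i < n)%N -> `|c i *: u i| `^ q <= Psi n c.
Proof.
(* There is one colour: [i] receives 0 and every other index the discarded colour 1. *)
move=> ltin; have := Psi_ub n c (1%N, fun j => if j == i then 0%N else 1%N).
rewrite /coloring_sum big_ord1 /= (big_pred1 (Ordinal ltin))// => j.
by rewrite /= -val_eqE /=; case: (_ == i).
Qed.

Lemma coloring_sumZ n s c p : 0 <= s ->
  coloring_sum n (fun i => s * c i) p = s `^ q * coloring_sum n c p.
Proof.
move=> s0; rewrite /coloring_sum mulr_sumr; apply: eq_bigr => j _.
rewrite -powRM//; congr (_ `^ q).
under eq_bigr do rewrite -scalerA.
by rewrite -scaler_sumr normrZ ger0_norm.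
Qed.

Lemma PsiZ n s c : 0 <= s -> Psi n (fun i => s * c i) <= s `^ q * Psi n c.
Proof.
move=> s0; apply: Psi_le => p; rewrite coloring_sumZ//.
by rewrite ler_wpM2l ?powR_ge0// Psi_ub.
Qed.

(** For a fixed colouring each colour contributes a convex function of the coefficients, and a
    supremum of convex functions is convex. *)
Lemma Psi_midpoint n a b :
  Psi n (fun i => (a i + b i) / 2) <= (Psi n a + Psi n b) / 2.
Proof.
apply: Psi_le => p; apply: (@le_trans _ _ ((coloring_sum n a p + coloring_sum n b p) / 2)).
  rewrite /coloring_sum -big_split /= mulr_suml; apply: ler_sum => j _.
  apply: le_trans (powR_midpoint q1 (normr_ge0 _) (normr_ge0 _)).
  rewrite ge0_ler_powR ?nnegrE ?divr_ge0 ?addr_ge0//.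
  under eq_bigr do rewrite mulrC -scalerA scalerDl.
  rewrite -scaler_sumr big_split /= normrZ ger0_norm ?invr_ge0//.
  by rewrite [leRHS]mulrC ler_wpM2l ?invr_ge0// ler_normD.
by rewrite ler_wpM2r ?invr_ge0// lerD ?Psi_ub.
Qed.

(** A colouring used on [A] and one used on its complement merge into a single colouring with
    disjoint palettes. *)
Lemma Psi_superadditive n c (A : pred nat) :
  Psi n (fun i => if A i then c i else 0) + Psi n (fun i => if A i then 0 else c i)
  <= Psi n c.
Proof.
rewrite -lerBrDr; apply: Psi_le => -[m1 x1]; rewrite lerBrDr addrC -lerBrDr.
apply: Psi_le => -[m2 x2]; rewrite lerBrDr addrC.
(* The second palette is shifted by [m1]. The colour [m1 + m2] is the first one not counted, so
   dropped indices stay dropped. *)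
pose x i := if A i then (if x1 i < m1 then x1 i else m1 + m2)%N
            else (if x2 i < m2 then m1 + x2 i else m1 + m2)%N.
apply: le_trans (Psi_ub n c ((m1 + m2)%N, x)).
rewrite /coloring_sum /= big_split_ord /= lerD//; apply: ler_sum => j _.
  rewrite [X in `|X| `^ q](_ : _ = \sum_(i < n | x i == j) c i *: u i)//.
  rewrite (bigID (fun i : 'I_n => A i)) /= [X in _ + X]big1 ?addr0; last first.
    by move=> i /andP[_ /negPf ->]; rewrite scale0r.
  rewrite [RHS](bigID (fun i : 'I_n => A i)) /= [X in _ = _ + X]big1 ?addr0; last first.
    move=> i /andP[+ /negPf Ai]; rewrite /x Ai; case: ifP => _ /eqP ij.
      by have := ltn_ord j; rewrite -ij ltnNge leq_addr.
    by have := ltn_ord j; rewrite -ij ltnNge leq_addr.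
  apply: eq_big => [i|i /andP[_ ->]//]; rewrite /x.
  case Ai: (A i); rewrite ?andbF//= !andbT; case: ltnP => // m1x.
  apply/eqP/eqP => ij.
    by have := ltn_ord j; rewrite -ij ltnNge m1x.
  by have := ltn_ord j; rewrite -ij ltnNge leq_addr.
rewrite [X in `|X| `^ q](_ : _ = \sum_(i < n | (x i == m1 + j)%N) c i *: u i)//.
rewrite (bigID (fun i : 'I_n => A i)) /= [X in X + _]big1 ?add0r; last first.
  by move=> i /andP[_ ->]; rewrite scale0r.
rewrite [RHS](bigID (fun i : 'I_n => A i)) /= [X in _ = X + _]big1 ?add0r; last first.
  move=> i /andP[+ Ai]; rewrite /x Ai; case: ltnP => xm /eqP ij.
    by move: xm; rewrite ij ltnNge leq_addr.
  by have := ltn_ord j; rewrite -(ltn_add2l m1) -ij ltnn.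
apply: eq_big => [i|i /andP[_ /negPf ->]//]; rewrite /x.
case Ai: (A i); rewrite ?andbF//= !andbT; case: ltnP => m2x; rewrite ?eqn_add2l//.
apply/eqP/eqP => ij.
  by have := ltn_ord j; rewrite -ij ltnNge m2x.
by have := ltn_ord j; rewrite -ij ltnn.
Qed.

Lemma Psi_widen k n c : (k <= n)%N -> (forall i, (k <= i)%N -> c i = 0) -> Psi n c = Psi k c.
Proof.
move=> kn c0; suff e p : coloring_sum n c p = coloring_sum k c p.
  by rewrite /Psi (_ : coloring_sum n c = coloring_sum k c)//; exact/funext.
apply: eq_bigr => j _; congr (`|_| `^ q).
rewrite [in RHS](big_ord_widen_cond n (fun i => p.2 i == j) (fun i => c i *: u i))//.
rewrite [RHS]big_mkcondr /=; apply: eq_bigr => i _; case: ltnP => // ki.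
by rewrite c0// scale0r.
Qed.

(** Truncation is restriction to a set of indices, which cannot increase a nonnegative superadditive
    quantity. *)
Lemma Psi_mono k n c : (k <= n)%N -> Psi k c <= Psi n c.
Proof.
move=> kn; rewrite -(@eq_Psi k (fun i => if (i < k)%N then c i else 0)) => [|i ->//].
rewrite -(Psi_widen kn) => [|i]; last by rewrite leqNgt => /negPf ->.
apply: le_trans (Psi_superadditive n c (fun i => (i < k)%N)).
by rewrite lerDl Psi_ge0.
Qed.

End lattice_modulus.

(** * Approximate maximisers of [sum_i h_i ln y_i] *)

(** Indexing finite families by an injection from any finite type makes passing to blocks, and from
    [nat] to [nat * nat], a mere composition. *)
Definition unconditional_with {R : realType} {X : normedModType R} {T : Type}
    (K : R) (u : T -> X) : Prop :=
  forall (I : finType) (f : I -> T), injective f ->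
  forall a theta : I -> R, (forall i, `|theta i| <= 1) ->
  `|\sum_i (theta i * a i) *: u (f i)| <= K * `|\sum_i a i *: u (f i)|.

Section near_maximizer.
Context {R : realType} {X : normedModType R}.
Variables (u : nat -> X) (q : R) (D : R).
Implicit Types (c a b h y z : nat -> R) (k n : nat) (A : pred nat).

(** Since [ln 0 = 0] here, a vanishing coordinate would look optimal; positivity wherever [h] is
    positive excludes this. *)
Definition log_admissible n h z : Prop :=
  [/\ forall i, 0 <= z i, forall i, (i < n)%N -> 0 < h i -> 0 < z i & Psi u q n z <= 1].

(** The error [e] replaces the attainment of the supremum. *)
Definition near_maximizer n (e : R) h y : Prop :=
  log_admissible n h y /\ forall z, log_admissible n h z ->
    \sum_(i < n) h i * ln (z i) <= \sum_(i < n) h i * ln (y i) + e.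

Hypothesis q1 : 1 <= q.
Hypothesis lowD : lower_estimate u q D.
Hypothesis u1 : forall i, `|u i| = 1.

Let q0 : 0 < q. Proof. exact: lt_le_trans q1. Qed.

Lemma ln2_le1 : ln (2 : R) <= 1.
Proof. by have := @le_ln1Dx R 1 ltac:(lra); rewrite -natr1 addrC. Qed.

Lemma Psi_normalize n c (B : R) : 0 < B -> Psi u q n c <= B ->
  Psi u q n (fun i => (B `^ q^-1)^-1 * c i) <= 1.
Proof.
move=> B0 cB; apply: le_trans (PsiZ lowD n c _) _; first by rewrite invr_ge0 powR_ge0.
have -> : (B `^ q^-1)^-1 `^ q = B^-1.
  rewrite -powR_inv1 ?powR_ge0// -powRrM mulN1r powRN -powRrM mulVf ?gt_eqF//.
  by rewrite powRr1// ltW.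
by rewrite mulrC ler_pdivrMr ?mul1r.
Qed.

(** Normalised [u] forces [z i <= 1], so the sums are bounded above by 0, and a scaled constant
    vector is admissible; hence the supremum is finite and approached. Zeroing the coordinates from
    [n] on changes nothing. *)
Lemma near_maximizer_exists n (e : R) h : 0 < e -> (forall i, 0 <= h i) ->
  exists2 y, near_maximizer n e h y & forall i, (n <= i)%N -> y i = 0.
Proof.
move=> e0 h0.
pose S := [set \sum_(i < n) h i * ln (z i) | z in log_admissible n h].
have supS : has_sup S.
  split.
    pose B := Psi u q n (fun=> 1) + 1.
    have B0 : 0 < B by rewrite ltr_wpDl// (Psi_ge0 lowD).
    pose z (i : nat) := (B `^ q^-1)^-1 * 1.
    exists (\sum_(i < n) h i * ln (z i)); exists z => //; split.
    - by move=> i; rewrite /z mulr1 invr_ge0 powR_ge0.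
    - by move=> i _ _; rewrite /z mulr1 invr_gt0 powR_gt0.
    - by apply: (@Psi_normalize n (fun=> 1)) => //; rewrite lerDl.
  exists 0 => _ [z [z0 _ z1] <-]; apply: sumr_le0 => i _.
  apply: mulr_ge0_le0 => //; apply: ln_le0.
  have := le_trans (coord_le_Psi lowD z (ltn_ord i)) z1.
  rewrite normrZ u1 mulr1 ger0_norm// => zq.
  rewrite leNgt; apply/negP => z1'.
  have : 1 `^ q < z i `^ q by apply: gt0_ltr_powR => //; rewrite nnegrE.
  by rewrite powR1 ltNge zq.
have [_ [y [y0 y_gt0 y1] <-] yS] := sup_adherent e0 supS.
pose y' i := if (i < n)%N then y i else 0.
have yy' : \sum_(i < n) h i * ln (y' i) = \sum_(i < n) h i * ln (y i).
  by apply: eq_bigr => i _; rewrite /y' ltn_ord.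
exists y'; last by move=> i; rewrite /y' leqNgt => /negPf ->.
split; first split.
- by move=> i; rewrite /y'; case: ifP.
- by move=> i ltin hi; rewrite /y' ltin y_gt0.
- by rewrite (@eq_Psi _ _ _ _ _ _ y)// => i; rewrite /y' => ->.
move=> z Sz; rewrite yy' -lerBlDr; apply: le_trans (ltW yS).
rewrite lerD2r; apply: ub_le_sup; first by case: supS.
by exists z.
Qed.

(** Brings near maximisers of different lengths to a common length: the added indices carry weight
    0. *)
Lemma near_maximizer_widen k n (e : R) h y : (k <= n)%N ->
  near_maximizer k e h y -> (forall i, (k <= i)%N -> y i = 0) ->
  near_maximizer n e (fun i => if (i < k)%N then h i else 0) y.
Proof.
move=> kn [[y0 y_gt0 y1] ymax] yk.
have E z : \sum_(i < n) (if (i < k)%N then h i else 0) * ln (z i)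
    = \sum_(i < k) h i * ln (z i).
  rewrite (big_ord_widen n (fun i => h i * ln (z i)))// [RHS]big_mkcond /=.
  by apply: eq_bigr => i _; case: ifP => // _; rewrite mul0r.
split; first split=> //.
- by move=> i _; case: ifP => [ik|]; [exact: y_gt0|rewrite ltxx].
- by rewrite (Psi_widen _ _ kn).
move=> z [z0 z_gt0 z1]; rewrite !E; apply: ymax; split => //.
  by move=> i ik hi; apply: z_gt0; [exact: leq_trans kn|rewrite ik].
exact: le_trans (Psi_mono lowD z kn) z1.
Qed.

(* Compare [y] with the normalisation of [y + y 1_{~A}]: superadditivity of
   [Psi] then leaves little room for [y 1_A]. *)
Lemma near_maximizer_restrict n (e : R) h y A : near_maximizer n e h y ->
  0 <= e -> (forall i, 0 <= h i) -> 2^-1 <= \sum_(i < n) h i ->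
  let t := 4 * q * (\sum_(i < n | A i) h i + e) in
  Psi u q n (fun i => if A i then y i else 0) <= t /\
  1 - t <= Psi u q n (fun i => if A i then 0 else y i).
Proof.
move=> [[y0 y_gt0 y1] ymax] e0 h0 h12 t.
set P := Psi u q n (fun i => if A i then y i else 0).
set P' := Psi u q n (fun i => if A i then 0 else y i).
suff tP' : 1 - t <= P'.
  split=> //; have := le_trans (Psi_superadditive lowD n y A) y1.
  by rewrite -/P -/P'; lra.
have P'0 : 0 <= P' by exact: (Psi_ge0 lowD).
pose z0 i := y i + (if A i then 0 else y i).
(* By convexity [L] bounds [Psi] at the midpoint of [y] and its restriction off [A]; [z0] is twice
   that midpoint, whence the factor [2 ^ q] in [B]. *)
pose L := (1 + P') / 2.
have L0 : 0 < L by rewrite /L; lra.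
pose B := 2 `^ q * L.
have B0 : 0 < B by rewrite mulr_gt0// powR_gt0.
have z0B : Psi u q n z0 <= B.
  rewrite (@eq_Psi _ _ _ _ _ _ (fun i => 2 * ((y i + (if A i then 0 else y i)) / 2))); last first.
    by move=> i _; rewrite /z0; field.
  apply: le_trans (PsiZ lowD n _ _) _ => //.
  rewrite ler_wpM2l ?powR_ge0//; apply: le_trans (Psi_midpoint q1 lowD n _ _) _.
  by rewrite ler_wpM2r ?invr_ge0// lerD2r.
pose s := (B `^ q^-1)^-1.
have s0 : 0 < s by rewrite invr_gt0 powR_gt0.
have lns : ln s = - (ln 2 + q^-1 * ln L).
  rewrite lnV ?posrE ?powR_gt0// ln_powR lnM ?posrE ?powR_gt0// ln_powR.
  by rewrite mulrDr mulrA mulVf ?gt_eqF// mul1r.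
have zadm : log_admissible n h (fun i => s * z0 i).
  split.
  - by move=> i; rewrite /z0 mulr_ge0 ?addr_ge0//; [exact: ltW|case: ifP].
  - move=> i ltin hi; rewrite /z0 mulr_gt0// ltr_wpDr ?y_gt0//.
    by case: ifP.
  - exact: Psi_normalize.
have := ymax _ zadm; set E := \sum_(i < n) h i * ln (y i).
set H := \sum_(i < n) h i; rewrite -/H in h12.
set b := \sum_(i < n | A i) h i.
have -> : \sum_(i < n) h i * ln (s * z0 i) = E + H * ln s + (H - b) * ln 2.
  have -> : H - b = \sum_(i < n) (if A i then 0 else h i).
    rewrite /H /b (bigID (fun i : 'I_n => A i)) /= addrAC subrr add0r big_mkcond /=.
    by apply: eq_bigr => i _; rewrite if_neg.
  rewrite /E /H.
  rewrite 2!mulr_suml -2!big_split /=; apply: eq_bigr => i _.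
  have := h0 i; rewrite le_eqVlt => /predU1P[<-|hi].
    by rewrite !mul0r; case: ifP; rewrite !(mul0r,addr0).
  have yi := y_gt0 _ (ltn_ord i) hi.
  rewrite /z0; case: (A i) => /=.
    by rewrite addr0 mul0r addr0 lnM ?posrE// mulrDr addrC.
  have -> : y i + y i = 2 * y i by ring.
  rewrite lnM ?posrE ?mulr_gt0// lnM ?posrE//.
  by ring.
have b0 : 0 <= b by apply: sumr_ge0.
have ln20 : 0 <= ln (2 : R) by apply: ln_ge0; lra.
have lnL : ln L <= L - 1.
  by have := @le_ln1Dx R (L - 1) ltac:(lra); rewrite addrC subrK.
have := ln2_le1; move: lns ln20 => ->; move: (ln 2) => l l0 l1.
move=> ineq.
(* Doubling off [A] gains [(H - b) ln 2] and normalising costs [H ln 2], so only [b ln 2 <= b] is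
   left beside the term in [ln L]. *)
have ineq2 : H * (q^-1 * - ln L) <= e + b.
  have : b * l <= b by rewrite ler_piMr.
  by nra.
(* This uses [H >= 1/2]. Then [1 - L <= - ln L] and [1 - L = (1 - P') / 2] give the constant
   [4 q]. *)
have : - ln L <= 2 * q * (b + e).
  rewrite leNgt; apply/negP => bad.
  have : 2 * (b + e) < q^-1 * - ln L.
    by rewrite ltr_pdivlMl// mulrCA mulrA.
  set Q := q^-1 * _ in ineq2 *; move=> ltQ.
  have : 0 <= (H - 2^-1) * Q by rewrite mulr_ge0//; lra.
  by lra.
rewrite /t -/b /L in lnL *; lra.
Qed.

(* Compare both maximisers with their midpoint; on [A] the logarithmic gap
   [2 ln ((a + b) / 2) - ln a - ln b] is at least [eta ^ 2]. *)
Lemma near_maximizer_close n (e eta : R) h h' y y' :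
  near_maximizer n e h y -> near_maximizer n e h' y' ->
  0 < eta -> (forall i, 0 <= h i) -> (forall i, 0 <= h' i) ->
  \sum_(i < n | eta * (y i + y' i) < `|y i - y' i|) h i <=
    (2 * e + \sum_(i < n) `|h i - h' i|) / eta ^+ 2 + \sum_(i < n) `|h i - h' i|.
Proof.
move=> [[y0 y_gt0 y1] ymax] [[y'0 y'_gt0 y'1] y'max] eta0 h0 h'0.
pose A i := eta * (y i + y' i) < `|y i - y' i|.
rewrite -[leLHS]/(\sum_(i < n | A i) h i).
set d := \sum_(i < n) `|h i - h' i|.
pose m i := (y i + y' i) / 2.
have m1 : Psi u q n m <= 1.
  by apply: le_trans (Psi_midpoint q1 lowD n _ _) _; lra.
have m0 i : 0 <= m i by rewrite divr_ge0// addr_ge0.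
have hm : log_admissible n h m.
  split=> // i ltin hi; rewrite divr_gt0// ltr_pwDl//; exact: y_gt0.
have h'm : log_admissible n h' m.
  split=> // i ltin hi; rewrite divr_gt0// ltr_wpDl//; exact: y'_gt0.
have {ymax hm} := ymax m hm; rewrite -lerBlDl -sumrB => ymax.
have {y'max h'm} := y'max m h'm; rewrite -lerBlDl -sumrB => y'max.
(* The common weight [mu] allows the two optimality inequalities to be added. The excess of either
   measure over [mu] is charged to the l1 distance, since a midpoint loses at most [ln 2 <= 1] in
   logarithm. *)
pose mu i := Num.min (h i) (h' i).
have mu0 i : 0 <= mu i by rewrite le_min h0 h'0.
(* Where [mu] vanishes, [y i] or [y' i] may be 0, and the gap is set to 0. *)
pose g i := if 0 < mu i then 2 * ln (m i) - ln (y i) - ln (y' i) else 0.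
have key i : (i < n)%N -> mu i * g i <=
    (h i * ln (m i) - h i * ln (y i)) + (h' i * ln (m i) - h' i * ln (y' i)) + `|h i - h' i|.
  move=> ltin.
  have half (a b : R) : 0 < a -> 0 <= b -> - 1 <= ln ((a + b) / 2) - ln a.
    move=> a0 b0.
    have : ln (a / 2) <= ln ((a + b) / 2).
      by rewrite ler_ln ?posrE ?divr_gt0// ?ltr_pwDl// ler_wpM2r ?invr_ge0// lerDl.
    by rewrite ln_div ?posrE//; have := ln2_le1; lra.
  have lb : 0 < h i -> -1 <= ln (m i) - ln (y i).
    by move=> hi; apply: half => //; exact: y_gt0.
  have lb' : 0 < h' i -> -1 <= ln (m i) - ln (y' i).
    by move=> hi; rewrite /m (addrC (y i)); apply: half => //; exact: y'_gt0.
  rewrite /g; case: ltP => mui.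
    have [hi h'i] : 0 < h i /\ 0 < h' i by move: mui; rewrite lt_min => /andP.
    have {}lb := lb hi; have {}lb' := lb' h'i.
    rewrite /mu; case: (leP (h i) (h' i)) => hh'.
      have : 0 <= (h' i - h i) * (ln (m i) - ln (y' i) + 1) by rewrite mulr_ge0//; lra.
      by rewrite ler0_norm ?subr_le0//; lra.
    have : 0 <= (h i - h' i) * (ln (m i) - ln (y i) + 1) by rewrite mulr_ge0//; lra.
    by rewrite gtr0_norm ?subr_gt0//; lra.
  have : h i = 0 \/ h' i = 0.
    by move: mui; rewrite ge_min => /orP[] ?; [left|right]; apply: le_anti; rewrite ?h0 ?h'0 andbT.
  rewrite mulr0 => -[] hi.
    rewrite hi sub0r normrN !mul0r subrr add0r ger0_norm//.
    have := h'0 i; rewrite le_eqVlt => /predU1P[<-|h'i].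
      by rewrite !mul0r subrr addr0.
    have : 0 <= h' i * (ln (m i) - ln (y' i) + 1).
      by rewrite mulr_ge0//; have := lb' h'i; lra.
    by lra.
  rewrite hi subr0 !mul0r subrr addr0 ger0_norm//.
  have := h0 i; rewrite le_eqVlt => /predU1P[<-|h'i].
    by rewrite !mul0r subrr addr0.
  have : 0 <= h i * (ln (m i) - ln (y i) + 1).
    by rewrite mulr_ge0//; have := lb h'i; lra.
  by lra.
have sumg : \sum_(i < n) mu i * g i <= 2 * e + d.
  apply: (@le_trans _ _ (\sum_(i < n) ((h i * ln (m i) - h i * ln (y i)) +
      (h' i * ln (m i) - h' i * ln (y' i)) + `|h i - h' i|))).
    by apply: ler_sum => i _; exact: key.
  by rewrite 2!big_split /= -/d; lra.
(* The gap is [- ln (1 - r ^+ 2)] with [r] the relative difference, hence at least [r ^+ 2];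
   membership in [A] says that the modulus of [r] exceeds [eta]. *)
have gap i : (i < n)%N -> 0 < mu i -> 2 * ln (m i) - ln (y i) - ln (y' i) =
    - ln (1 - ((y i - y' i) / (y i + y' i)) ^+ 2) /\
    0 < 1 - ((y i - y' i) / (y i + y' i)) ^+ 2.
  move=> ltin; rewrite lt_min => /andP[hi h'i].
  have yi := y_gt0 _ ltin hi; have y'i := y'_gt0 _ ltin h'i.
  have yy' : 0 < y i + y' i by lra.
  have -> : 1 - ((y i - y' i) / (y i + y' i)) ^+ 2 = y i * y' i / (m i) ^+ 2.
    by rewrite /m; field; rewrite gt_eqF.
  have mi : 0 < m i by rewrite divr_gt0.
  split; last by rewrite divr_gt0 ?exprn_gt0 ?mulr_gt0.
  rewrite ln_div ?posrE ?exprn_gt0 ?mulr_gt0// lnM ?posrE// lnXn// mulr2n; lra.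
have g0 i : (i < n)%N -> 0 <= g i.
  move=> ltin; rewrite /g; case: ltP => // mui; have [-> p] := gap _ ltin mui.
  rewrite oppr_ge0; apply: ln_le0; rewrite gerBl; exact: sqr_ge0.
have gA i : (i < n)%N -> A i -> mu i * eta ^+ 2 <= mu i * g i.
  move=> ltin Ai; rewrite /g; case: ltP => mui; last first.
    by rewrite mulr0 mulr_le0_ge0// sqr_ge0.
  rewrite ler_wpM2l//; have [-> p] := gap _ ltin mui.
  move: p; set r := (y i - y' i) / (y i + y' i) => p.
  have : eta ^+ 2 <= r ^+ 2.
    rewrite -[leRHS]real_normK ?num_real// lerXn2r ?nnegrE ?normr_ge0// ?ltW//.
    move: mui; rewrite lt_min => /andP[hi h'i].
    have yi := y_gt0 _ ltin hi; have y'i := y'_gt0 _ ltin h'i.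
    have yy' : 0 < y i + y' i by lra.
    by rewrite /r normrM normfV (gtr0_norm yy') ltr_pdivlMr.
  have := @le_ln1Dx R (- r ^+ 2) ltac:(lra); lra.
have muA : \sum_(i < n | A i) mu i <= (2 * e + d) / eta ^+ 2.
  rewrite ler_pdivlMr ?exprn_gt0// mulr_suml; apply: le_trans sumg.
  rewrite big_mkcond; apply: ler_sum => i _; case: ifPn => Ai; first exact: gA.
  by rewrite mulr_ge0// g0.
have : \sum_(i < n | A i) h i <= \sum_(i < n | A i) mu i + d.
  rewrite -lerBlDl -sumrB /d [leLHS]big_mkcond; apply: ler_sum => i _.
  case: ifP => _; last exact: normr_ge0.
  have [->|->] : mu i = h i \/ mu i = h' i.
    by rewrite /mu /Num.min; case: ifP; [left|right].
  - by rewrite subrr normr_ge0.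
  - exact: ler_norm.
lra.
Qed.

End near_maximizer.

(** * Embedding probabilities into the space *)

Section sequence_limits.
Context {R : realType}.

Lemma cvgn_of_cauchy (V : completeNormedModType R) (v : nat -> V) :
  (forall e : R, 0 < e ->
    exists N, forall n m, (N <= n)%N -> (n <= m)%N -> `|v n - v m| <= e) -> cvgn v.
Proof.
move=> vC; apply/cauchy_cvgP/cauchy_exP => e e0.
have [N vN] := vC _ (divr_gt0 e0 (ltr0Sn R 1)).
exists (v N), N => // m /= Nm; rewrite -ball_normE /=.
by apply: le_lt_trans (vN _ _ (leqnn N) Nm) _; rewrite ltr_pdivrMr// ltr_pMr// ltr1n.
Qed.

Context {V : normedModType R}.
Implicit Types (v w : nat -> V) (a b : V).

Lemma norm_cvgn_le v a (B : R) : v @ \oo --> a ->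
  (\forall n \near \oo, `|v n| <= B) -> `|a| <= B.
Proof. by move=> va; apply: cvgr_to_le; exact: cvg_norm. Qed.

Lemma norm_cvgn_ge v a (B : R) : v @ \oo --> a ->
  (\forall n \near \oo, B <= `|v n|) -> B <= `|a|.
Proof. by move=> va; apply: cvgr_to_ge; exact: cvg_norm. Qed.

End sequence_limits.

Section simplex_embedding.
Context {R : realType} {X : completeNormedModType R}.
Variables (u : nat -> X) (q D K : R).
Implicit Types (c a b h y z : nat -> R) (k n : nat) (A : pred nat).
Hypotheses (q1 : 1 <= q) (lowD : lower_estimate u q D) (u1 : forall i, `|u i| = 1).
Hypotheses (D0 : 0 < D) (K0 : 0 < K) (uK : unconditional_with K u).

Let q0 : 0 < q. Proof. exact: lt_le_trans q1. Qed.

Lemma norm_le_powR (t B : R) : 0 <= t -> 0 <= B -> t `^ q <= B -> t <= B `^ q^-1.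
Proof.
move=> t0 B0 tB; rewrite -[t in leLHS](@powRr1 R)// -(mulfV (lt0r_neq0 q0)) powRrM.
by rewrite ge0_ler_powR ?nnegrE ?powR_ge0// invr_ge0 ltW.
Qed.

Lemma powR_le_norm (t B : R) : 0 <= t -> 0 <= B -> B <= t `^ q -> B `^ q^-1 <= t.
Proof.
move=> t0 B0 tB; rewrite -[t in leRHS](@powRr1 R)// -(mulfV (lt0r_neq0 q0)) powRrM.
by rewrite ge0_ler_powR ?nnegrE ?powR_ge0// invr_ge0 ltW.
Qed.

Lemma unconditional_ord n c (theta : nat -> R) : (forall i, `|theta i| <= 1) ->
  `|\sum_(i < n) (theta i * c i) *: u i| <= K * `|\sum_(i < n) c i *: u i|.
Proof. by move=> th; exact: (uK val_inj (fun i => c (val i)) (fun i => th (val i))). Qed.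

Lemma near_maximizer_le n (e e' : R) h y : e <= e' ->
  near_maximizer u q n e h y -> near_maximizer u q n e' h y.
Proof.
move=> ee' [ya ymax]; split=> // z /ymax /le_trans; apply; by rewrite lerD2l.
Qed.

Lemma near_maximizer_norm n (e : R) h y : near_maximizer u q n e h y ->
  `|\sum_(i < n) y i *: u i| <= 1.
Proof.
move=> [[_ _ y1] _].
have := norm_le_powR (normr_ge0 _) ler01 (le_trans (norm_le_Psi lowD _ _) y1).
by rewrite powR1.
Qed.

(** On the set [A] of large relative difference both measures have little mass, so both vectors are
    small there. Off [A] the difference is [eta * (y + y')] times a multiplier of modulus at most 1,
    which unconditionality controls. *)
Lemma near_maximizer_dist n (e eta d : R) h h' y y' :
  near_maximizer u q n e h y -> near_maximizer u q n e h' y' ->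
  0 <= e -> 0 < eta -> (forall i, 0 <= h i) -> (forall i, 0 <= h' i) ->
  2^-1 <= \sum_(i < n) h i -> 2^-1 <= \sum_(i < n) h' i ->
  d = \sum_(i < n) `|h i - h' i| ->
  `|\sum_(i < n) (y i - y' i) *: u i| <= 2 * K * eta +
     2 * (4 * q * ((2 * e + d) / eta ^+ 2 + d + e)) `^ q^-1.
Proof.
move=> my my' e0 eta0 h0 h'0 h12 h'12 dE.
pose A i := eta * (y i + y' i) < `|y i - y' i|.
have [y0 _ y1] := my.1; have [y'0 _ y'1] := my'.1.
have hA : \sum_(i < n | A i) h i <= (2 * e + d) / eta ^+ 2 + d.
  by rewrite dE; exact: near_maximizer_close my my' eta0 h0 h'0.
have hA' : \sum_(i < n | A i) h' i <= (2 * e + d) / eta ^+ 2 + d.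
  have := near_maximizer_close q1 lowD my' my eta0 h'0 h0.
  have -> : \sum_(i < n) `|h' i - h i| = d by rewrite dE; apply: eq_bigr => i _; rewrite distrC.
  congr (_ <= _); apply: eq_bigl => i; by rewrite /A distrC addrC.
set k := 4 * q * _.
have small c g : near_maximizer u q n e g c -> (forall i, 0 <= g i) ->
    2^-1 <= \sum_(i < n) g i -> \sum_(i < n | A i) g i <= (2 * e + d) / eta ^+ 2 + d ->
    `|\sum_(i < n) (if A i then c i else 0) *: u i| <= k `^ q^-1.
  move=> mc g0 g12 gA.
  have [cA _] := near_maximizer_restrict q1 lowD A mc e0 g0 g12.
  have ck : Psi u q n (fun i => if A i then c i else 0) <= k.
    by apply: le_trans cA _; rewrite /k ler_wpM2l ?mulr_ge0 ?(ltW q0)// lerD2r.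
  apply: norm_le_powR => //; first exact: le_trans (Psi_ge0 lowD _ _) ck.
  exact: le_trans (norm_le_Psi lowD _ _) ck.
(* If [y i + y' i = 0] the quotient is 0 by convention, which is consistent because then
   [y i = y' i] off [A]. *)
pose theta i := if A i then 0 else (y i - y' i) / (eta * (y i + y' i)).
have th i : `|theta i| <= 1.
  rewrite /theta; case: ifPn => Ai; first by rewrite normr0.
  have yy' : 0 <= eta * (y i + y' i) by rewrite mulr_ge0 ?addr_ge0// ltW.
  move: Ai; rewrite /A -leNgt normrM normfV (ger0_norm yy').
  move: yy'; rewrite le_eqVlt => /predU1P[<-|yy'] le1.
    by rewrite invr0 mulr0.
  by rewrite ler_pdivrMr// mul1r.
have -> : \sum_(i < n) (y i - y' i) *: u i =
  \sum_(i < n) (theta i * (eta * (y i + y' i))) *: u i +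
  (\sum_(i < n) (if A i then y i else 0) *: u i -
   \sum_(i < n) (if A i then y' i else 0) *: u i).
  rewrite -sumrB -big_split /=; apply: eq_bigr => i _.
  rewrite -scalerBl -scalerDl; congr (_ *: _); rewrite /theta.
  case: ifPn => Ai; first by rewrite mul0r add0r.
  rewrite subrr addr0; have [yy'|yy'] := eqVneq (eta * (y i + y' i)) 0.
    move: Ai; rewrite /A -leNgt yy' mulr0 => Ai.
    by apply/eqP; rewrite -normr_le0.
  by rewrite divfK.
have sumyy' : `|\sum_(i < n) (eta * (y i + y' i)) *: u i| <= eta * 2.
  under eq_bigr do rewrite -scalerA scalerDl.
  rewrite -scaler_sumr normrZ (gtr0_norm eta0) ler_pM2l// big_split /=.
  apply: le_trans (ler_normD _ _) _.
  have := near_maximizer_norm my; have := near_maximizer_norm my'.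
  by lra.
apply: le_trans (ler_normD _ _) _; apply: lerD.
  apply: le_trans (unconditional_ord n (fun i => eta * (y i + y' i)) th) _.
  apply: le_trans (ler_wpM2l (ltW K0) sumyy') _.
  by rewrite (mulrC eta) mulrA (mulrC K).
apply: le_trans (ler_normB _ _) _; rewrite mulr_natl mulr2n.
by apply: lerD; [exact: small my _ _ _|exact: small my' _ _ _].
Qed.

Lemma near_maximizer_modulus (w : R) : 0 < w -> exists2 d : R, 0 < d &
  forall n (e : R) h h' y y',
  near_maximizer u q n e h y -> near_maximizer u q n e h' y' ->
  0 <= e <= d -> (forall i, 0 <= h i) -> (forall i, 0 <= h' i) ->
  2^-1 <= \sum_(i < n) h i -> 2^-1 <= \sum_(i < n) h' i ->
  \sum_(i < n) `|h i - h' i| <= d ->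
  `|\sum_(i < n) (y i - y' i) *: u i| <= w.
Proof.
(* In the bound of [near_maximizer_dist], [eta] makes the first term [w / 2]; the bracket is at most
   [E * d], and [d] is chosen with [4 * q * E * d = (w / 4) ^ q], so the second term is at most
   [w / 2]. *)
move=> w0; pose eta := w / (4 * K).
have eta0 : 0 < eta by rewrite divr_gt0// mulr_gt0.
pose E := 3 / eta ^+ 2 + 2.
have E0 : 0 < E by rewrite addr_gt0// divr_gt0// exprn_gt0.
pose d := (w / 4) `^ q / (4 * q * E).
have d0 : 0 < d by rewrite divr_gt0 ?powR_gt0 ?divr_gt0// !mulr_gt0.
exists d => // n e h h' y y' my my' /andP[e0 ed] h0 h'0 h12 h'12 dd.
apply: le_trans (near_maximizer_dist my my' e0 eta0 h0 h'0 h12 h'12 erefl) _.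
set d' := \sum_(i < n) _ in dd *.
have d'0 : 0 <= d' by apply: sumr_ge0.
have -> : 2 * K * eta = w / 2 by rewrite /eta; field; rewrite gt_eqF.
suff : (4 * q * ((2 * e + d') / eta ^+ 2 + d' + e)) `^ q^-1 <= w / 4 by lra.
have pos : 0 <= (2 * e + d') / eta ^+ 2 + d' + e.
  by rewrite !addr_ge0// mulr_ge0 ?invr_ge0 ?sqr_ge0// addr_ge0// mulr_ge0.
apply: powR_le_norm; first by rewrite divr_ge0// ltW.
  by rewrite mulr_ge0// mulr_ge0// ltW.
have -> : (w / 4) `^ q = 4 * q * (E * d).
  by rewrite /d; field; rewrite !gt_eqF.
have -> : E * d = 3 * d / eta ^+ 2 + 2 * d by rewrite /E mulrDl mulrAC.
rewrite ler_pM2l ?mulr_gt0// -addrA; apply: lerD; last by lra.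
by rewrite ler_wpM2r ?invr_ge0 ?sqr_ge0//; lra.
Qed.

(** On [A] the vector [y] keeps most of its [Psi] while [y'] is small; restricting the difference to
    [A] costs only the factor [K]. *)
Lemma near_maximizer_separated : exists2 c : R, 0 < c & exists2 t : R, 0 < t &
  forall n (e : R) h h' y y' A,
  near_maximizer u q n e h y -> near_maximizer u q n e h' y' ->
  0 <= e <= t -> (forall i, 0 <= h i) -> (forall i, 0 <= h' i) ->
  2^-1 <= \sum_(i < n) h i -> 2^-1 <= \sum_(i < n) h' i ->
  \sum_(i < n | ~~ A i) h i <= t -> \sum_(i < n | A i) h' i <= t ->
  c <= `|\sum_(i < n) (y i - y' i) *: u i|.
Proof.
(* [r] is the norm forced by [Psi >= 1/2]. Masses and errors up to [s / (8 q)] give losses up to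
   [s], which leaves [y] at least [Psi = 1/2] on [A] and [y'] norm at most [r / 2] there. *)
pose r := ((2 * D)^-1) `^ q^-1.
have r0 : 0 < r by rewrite powR_gt0 ?invr_gt0 ?mulr_gt0.
pose s := Num.min 2^-1 ((r / 2) `^ q).
have s0 : 0 < s by rewrite lt_min invr_gt0 ltr0n/= powR_gt0// divr_gt0.
exists (r / 2 / K); first by rewrite !divr_gt0.
exists (s / (8 * q)); first by rewrite divr_gt0// mulr_gt0.
move=> n e h h' y y' A my my' /andP[e0 es] h0 h'0 h12 h'12 hA h'A.
have le_s (x : R) : x <= s / (8 * q) -> 4 * q * (x + e) <= s.
  move=> xs; have : x + e <= s / (8 * q) *+ 2 by rewrite mulr2n lerD.
  move=> /(ler_wpM2l (ltW (mulr_gt0 (ltr0Sn R 3) q0))) /le_trans; apply.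
  by rewrite le_eqVlt; apply/orP; left; apply/eqP; field; rewrite gt_eqF.
have [_ yA] := near_maximizer_restrict q1 lowD (fun i => ~~ A i) my e0 h0 h12.
have [y'A _] := near_maximizer_restrict q1 lowD A my' e0 h'0 h'12.
have s12 : s <= 2^-1 by rewrite ge_min lexx.
have sr : s <= (r / 2) `^ q by rewrite ge_min lexx orbT.
have yl : r <= `|\sum_(i < n) (if A i then y i else 0) *: u i|.
  have : 2^-1 <= D * `|\sum_(i < n) (if A i then y i else 0) *: u i| `^ q.
    apply: le_trans (Psi_le_norm lowD n (fun i => if A i then y i else 0)).
    rewrite (@eq_Psi _ _ u q n _ (fun i => if ~~ A i then 0 else y i)); last first.
      by move=> i _; rewrite if_neg.
    by apply: le_trans yA; have := le_s _ hA; lra.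
  rewrite mulrC -ler_pdivrMr// -invfM => le.
  by apply: powR_le_norm => //; rewrite invr_ge0 mulr_ge0// ltW.
have y'u : `|\sum_(i < n) (if A i then y' i else 0) *: u i| <= r / 2.
  have -> : r / 2 = (r / 2) `^ q `^ q^-1.
    by rewrite -powRrM mulfV ?lt0r_neq0// powRr1// divr_ge0// ltW.
  apply: norm_le_powR; rewrite ?powR_ge0//; apply: le_trans sr.
  apply: le_trans (norm_le_Psi lowD n (fun i => if A i then y' i else 0)) _.
  by apply: le_trans y'A _; exact: le_s.
pose theta i : R := if A i then 1 else 0.
have th i : `|theta i| <= 1 by rewrite /theta; case: ifP; rewrite ?normr1 ?normr0.
rewrite ler_pdivrMr// [leRHS]mulrC.
apply: le_trans _ (unconditional_ord n (fun i => y i - y' i) th).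
have -> : \sum_(i < n) (theta i * (y i - y' i)) *: u i =
   \sum_(i < n) (if A i then y i else 0) *: u i -
   \sum_(i < n) (if A i then y' i else 0) *: u i.
  rewrite -sumrB; apply: eq_bigr => i _; rewrite -scalerBl /theta.
  by case: ifP => _; rewrite ?mul1r ?mul0r ?subrr.
apply: le_trans _ (lerB_dist _ _); lra.
Qed.

Definition probability_weights h : Prop :=
  (forall i, 0 <= h i) /\ (fun n => \sum_(i < n) h i) @ \oo --> (1 : R).

(** The estimates on near maximisers ask only for mass at least 1/2, so that they apply to long
    truncations of a probability. *)
Lemma probability_weights_ge12 h : probability_weights h ->
  \forall n \near \oo, 2^-1 <= \sum_(i < n) h i.
Proof.
move=> [h0 h1]; apply: (cvgr_ge (1 : R)) => //.
by rewrite invf_lt1 ?ltr1n.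
Qed.

(** The image of [h] is the limit of near maximisers for its first [n] coordinates with error
    [1 / (n + 1)]. The sequence is Cauchy by the modulus estimate, since truncations of [h] converge
    in l1, and both estimates pass to the limit. *)
Lemma simplex_embedding : exists2 phi : (nat -> R) -> X,
  forall h, probability_weights h -> `|phi h| <= 1 /\
    exists c : nat -> nat -> R, (fun n => \sum_(i < n) c n i *: u i) @ \oo --> phi h
  & (forall w : R, 0 < w -> exists2 d : R, 0 < d & forall h h',
      probability_weights h -> probability_weights h' ->
      (forall n, \sum_(i < n) `|h i - h' i| <= d) -> `|phi h - phi h'| <= w) /\
  exists2 c : R, 0 < c & exists2 t : R, 0 < t & forall h h' A,
      probability_weights h -> probability_weights h' ->
      (forall n, \sum_(i < n | ~~ A i) h i <= t) -> (forall n, \sum_(i < n | A i) h' i <= t) ->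
      c <= `|phi h - phi h'|.
Proof.
have inv0 n : 0 < n.+1%:R^-1 :> R by rewrite invr_gt0.
(* Nonnegativity is a premise inside the existential, so that [choice] applies to every pair. *)
have : forall p : (nat -> R) * nat, exists y, (forall i, 0 <= p.1 i) ->
    near_maximizer u q p.2 p.2.+1%:R^-1 p.1 y /\ forall i, (p.2 <= i)%N -> y i = 0.
  move=> [h n] /=; have [h0|nh0] := pselect (forall i, 0 <= h i); last by exists h.
  by have [y ? ?] := near_maximizer_exists q1 lowD u1 n (inv0 n) h0; exists y.
move=> /choice[Y0 HY0]; pose Y h n := Y0 (h, n).
have HY h n : (forall i, 0 <= h i) -> near_maximizer u q n n.+1%:R^-1 h (Y h n) /\
    forall i, (n <= i)%N -> Y h n i = 0 by move=> h0; exact: (HY0 (h, n)).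
pose S h n := \sum_(i < n) Y h n i *: u i.
have small (e : R) : 0 < e -> \forall n \near \oo, n.+1%:R^-1 <= e.
  move=> e0; have := near_infty_natSinv_lt (PosNum e0).
  by apply: filterS => n /ltW.
have cvS h : probability_weights h -> cvgn (S h).
  move=> ph; have [h0 h1] := ph; apply: cvgn_of_cauchy => w w0.
  have [d d0 Hd] := near_maximizer_modulus w0.
  have [N1 _ HN1] := small _ d0.
  have [N2 _ HN2] := probability_weights_ge12 ph.
  have [N3 _ HN3] : \forall n \near \oo, 1 - \sum_(i < n) h i <= d.
    move/cvgrPdist_le : h1 => /(_ _ d0); apply: filterS => n.
    by move=> /(le_trans (ler_norm _)).
  exists (maxn N1 (maxn N2 N3)) => n m; rewrite !geq_max => /and3P[n1 n2 n3] nm.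
  have [mn n0] := HY h n h0; have [mm m0] := HY h m h0.
  have E : S h n = \sum_(i < m) Y h n i *: u i.
    rewrite /S (big_ord_widen m (fun i => Y h n i *: u i))// big_mkcond /=.
    apply: eq_bigr => i _; case: ltnP => // ni; by rewrite n0// scale0r.
  rewrite E /S -sumrB; under eq_bigr do rewrite -scalerBl.
  have nm' : m.+1%:R^-1 <= n.+1%:R^-1 :> R by rewrite lef_pV2 ?posrE// ler_nat.
  have htr : \sum_(i < m) (if (i < n)%N then h i else 0) = \sum_(i < n) h i.
    by rewrite [RHS](big_ord_widen m h)// [RHS]big_mkcond.
  apply: (Hd m n.+1%:R^-1 (fun i => if (i < n)%N then h i else 0) h) => //.
  - exact: (near_maximizer_widen lowD nm mn n0).
  - exact: near_maximizer_le nm' mm.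
  - by rewrite (ltW (inv0 n)) HN1.
  - by move=> i; case: ifP.
  - by rewrite htr HN2.
  - by rewrite HN2//; exact: leq_trans nm.
  (* The l1 distance between the truncations is the mass of [h] from [n] to [m], at most the
     tail. *)
  have -> : \sum_(i < m) `|(if (i < n)%N then h i else 0) - h i| =
      \sum_(i < m) h i - \sum_(i < n) h i.
    rewrite -htr -sumrB; apply: eq_bigr => i _; case: ifP => _.
      by rewrite subrr normr0.
    by rewrite sub0r subr0 normrN ger0_norm.
  apply: le_trans (HN3 n n3); rewrite lerD2r.
  have : nondecreasing_seq (fun n => \sum_(i < n) h i).
    by apply/nondecreasing_seqP => k; rewrite big_ord_recr lerDl.
  by move=> /nondecreasing_cvgn_le /(_ (cvgP _ h1) m); rewrite (cvg_lim _ h1).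
pose phi h := limn (S h).
have Sphi h : probability_weights h -> S h @ \oo --> phi h by exact: cvS.
have Sphi2 h h' : probability_weights h -> probability_weights h' ->
    (fun n => \sum_(i < n) (Y h n i - Y h' n i) *: u i) @ \oo --> phi h - phi h'.
  move=> ph ph'.
  have -> : (fun n => \sum_(i < n) (Y h n i - Y h' n i) *: u i) = (fun n => S h n - S h' n).
    by apply/funext => n; rewrite /S -sumrB; apply: eq_bigr => i _; rewrite scalerBl.
  by apply: cvgB; exact: Sphi.
exists phi => [h ph|]; first split.
- apply: norm_cvgn_le (Sphi h ph) _; apply: nearW => n.
  by apply: near_maximizer_norm (HY h n _).1; case: ph.
- by exists (Y h); exact: Sphi.
split=> [w w0|].
  have [d d0 Hd] := near_maximizer_modulus w0.
  exists d => // h h' ph ph' hh'; apply: norm_cvgn_le (Sphi2 h h' ph ph') _.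
  apply: filterS3 (probability_weights_ge12 ph) (probability_weights_ge12 ph') (small _ d0).
  move=> n h12 h'12 nd; apply: Hd (HY h n ph.1).1 (HY h' n ph'.1).1 _ ph.1 ph'.1 h12 h'12 (hh' n).
  by rewrite nd (ltW (inv0 n)).
have [c c0 [t t0 Hc]] := near_maximizer_separated.
exists c => //; exists t => // h h' A ph ph' hA h'A.
apply: norm_cvgn_ge (Sphi2 h h' ph ph') _.
apply: filterS3 (probability_weights_ge12 ph) (probability_weights_ge12 ph') (small _ t0).
move=> n h12 h'12 nt.
apply: Hc (HY h n ph.1).1 (HY h' n ph'.1).1 _ ph.1 ph'.1 h12 h'12 (hA n) (h'A n).
by rewrite nt (ltW (inv0 n)).
Qed.

End simplex_embedding.

(** * Poisson measures on words *)

Section word_sums.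
Context {R : realType}.

Lemma esumZl (T : choiceType) (S : set T) (r : R) (a : T -> \bar R) :
  0 <= r -> (forall t, 0 <= a t)%E ->
  \esum_(t in S) (r%:E * a t)%E = (r%:E * \esum_(t in S) a t)%E.
Proof.
move=> r0 a0.
(* One inequality suffices: used with [r^-1] it gives the converse. *)
have le s (b : T -> \bar R) : 0 <= s -> (forall t, 0 <= b t)%E ->
    (\esum_(t in S) (s%:E * b t)%E <= s%:E * \esum_(t in S) b t)%E.
  move=> s0 b0; apply: ge_ereal_sup => _ [F SF <-].
  rewrite -ge0_mule_fsumr//; apply: lee_pmul => //; first exact: fsume_ge0.
  by apply: ereal_sup_ubound; exists F.
move: r0; rewrite le_eqVlt => /predU1P[<-|r0].
  by rewrite mul0e; apply: esum1 => t _; rewrite mul0e.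
apply/eqP; rewrite eq_le le ?(ltW r0)//=.
have := le r^-1 (fun t => r%:E * a t)%E; rewrite invr_ge0 (ltW r0).
have -> : (fun t => r^-1%:E * (r%:E * a t))%E = a.
  by apply/funext => t; rewrite muleA -EFinM mulVf ?gt_eqF// mul1e.
move=> /(_ isT) /(_ _) le'.
rewrite -lee_pdivlMl//; apply: le' => t; apply: mule_ge0 => //; by rewrite lee_fin ltW.
Qed.

Lemma partial_sums_EFin (f : nat -> R) :
  (fun n => \sum_(0 <= i < n) (f i)%:E)%E = EFin \o (fun n => \sum_(i < n) f i).
Proof. by apply/funext => n /=; rewrite sumEFin big_mkord. Qed.

Lemma cvgn_esum (f : nat -> R) (v : R) : (forall i, 0 <= f i) ->
  (fun n => \sum_(i < n) f i) @ \oo --> v -> \esum_(i in [set: nat]) (f i)%:E = v%:E.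
Proof.
move=> f0 fv; rewrite -nneseries_esumT => [|i]; last by rewrite lee_fin.
by rewrite partial_sums_EFin EFin_lim; [rewrite (cvg_lim _ fv)|exact: cvgP fv].
Qed.

Lemma esum_cvgn (f : nat -> R) (v : R) : (forall i, 0 <= f i) ->
  \esum_(i in [set: nat]) (f i)%:E = v%:E -> (fun n => \sum_(i < n) f i) @ \oo --> v.
Proof.
move=> f0; rewrite -nneseries_esumT => [|i]; last by rewrite lee_fin.
have : cvgn (fun n => \sum_(0 <= i < n) (f i)%:E)%E.
  by apply: is_cvg_nneseries => n _ _; rewrite lee_fin.
by rewrite partial_sums_EFin => + fv; rewrite fv => /fine_cvgP[].
Qed.

Variable T : choiceType.
Variables (b : T -> R) (B : R).
Hypotheses (b0 : forall t, 0 <= b t) (bB : \esum_(t in [set: T]) (b t)%:E = B%:E).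

Lemma sum_ge0 : 0 <= B.
Proof. by rewrite -lee_fin -bB; apply: esum_ge0 => t _; rewrite lee_fin. Qed.

(** Splitting off the first letter and summing iteratively yields one factor [B] per letter. *)
Lemma esum_words_size n :
  \esum_(w in [set w : seq T | size w = n]) (\prod_(t <- w) b t)%:E = (B ^+ n)%:E.
Proof.
elim: n => [|n IH].
  rewrite (_ : [set w | size w = 0%N] = [set [::]]); last first.
    by apply/seteqP; split => [w /size0nil|_ ->].
  by rewrite esum_set1 ?big_nil.
have p0 w : 0 <= \prod_(t <- w) b t by apply: prodr_ge0.
rewrite (reindex_esum ([set: T] `*` [set w | size w = n]) _ (fun p => p.1 :: p.2)); last first.
  split=> [[t w] [_ /= <-]//|[t w] [t' w'] _ _ [-> ->]//|[|t w]//= [wn]].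
  by exists (t, w).
under eq_esum do rewrite big_cons EFinM.
rewrite -(@esum_esum _ _ _ setT (fun=> [set w | size w = n])
  (fun t w => (b t)%:E * (\prod_(t <- w) b t)%:E)%E); last first.
  by move=> t w _ _; rewrite -EFinM lee_fin mulr_ge0.
under eq_esum do rewrite esumZl// IH muleC.
by rewrite esumZl ?bB ?exprn_ge0 ?sum_ge0// -EFinM exprSr.
Qed.

(** Grouping words by length produces the exponential series. *)
Lemma esum_words : \esum_(w in [set: seq T]) ((size w)`!%:R^-1 * \prod_(t <- w) b t)%:E
  = (expR B)%:E.
Proof.
have p0 w : 0 <= \prod_(t <- w) b t by apply: prodr_ge0.
rewrite (_ : [set: seq T] = \bigcup_n [set w | size w = n]); last first.
  by apply/seteqP; split => // w _; exists (size w).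
rewrite nneseries_sum_bigcup; first last.
- by move=> w; rewrite lee_fin mulr_ge0 ?invr_ge0.
- by move=> i j _ _ [w /= [<- <-]].
have -> : (fun n => \sum_(0 <= i < n) \esum_(w in [set w | size w = i])
    ((size w)`!%:R^-1 * \prod_(t <- w) b t)%:E)%E = EFin \o series (exp_coeff B).
  apply/funext => n /=; rewrite /series /= -sumEFin; apply: eq_bigr => i _.
  under eq_esum => w /= -> do rewrite EFinM.
  by rewrite esumZl ?invr_ge0// esum_words_size -EFinM /exp_coeff /= mulrC.
by rewrite EFin_lim//; exact: is_cvg_series_exp_coeff.
Qed.

End word_sums.

(** Moves a sum over a countable type to [nat]; numbers that code nothing contribute the default
    0. *)
Lemma esum_pickle {R : realType} (T : countType) (f : T -> R) : (forall t, 0 <= f t) ->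
  \esum_(i in [set: nat]) (oapp f 0 (@pickle_inv T i))%:E = \esum_(t in [set: T]) (f t)%:E.
Proof.
move=> f0.
rewrite (esumID (range (@pickle T))) => [|i _]; last first.
  by rewrite lee_fin; case: (@pickle_inv T i) => /=.
rewrite setTI [X in (_ + X)%E]esum1 ?adde0 => [|i [_ ni]]; last first.
  case E: (@pickle_inv T i) => [t|]//=; exfalso; apply: ni.
  by exists t => //; have := @pickle_invK T i; rewrite /ocancel E.
rewrite esum_image; last by move=> s t _ _; exact: (pcan_inj (@pickleK_inv T)).
by apply: eq_esum => t _; rewrite pickleK_inv.
Qed.

Lemma partial_sum_le {R : realType} (f : nat -> R) (v : R) n : (forall i, 0 <= f i) ->
  (fun n => \sum_(i < n) f i) @ \oo --> v -> \sum_(i < n) f i <= v.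
Proof.
move=> f0 fv; rewrite -(cvg_lim _ fv)//.
apply: (@nondecreasing_cvgn_le R (fun n => \sum_(i < n) f i)); last exact: cvgP fv.
by apply/nondecreasing_seqP => k; rewrite big_ord_recr lerDl.
Qed.

(** * Exponential vectors and their overlaps *)

Section fock.
Context {R : realType}.
Implicit Types (x y : ell2 R).

Lemma ell2_sqr_cvg x : (fun n => \sum_(i < n) (x i) ^+ 2) @ \oo --> `|x| ^+ 2.
Proof.
apply: (@esum_cvgn R (fun i => x i ^+ 2) (`|x| ^+ 2)) => [i|]; first exact: sqr_ge0.
rewrite -nneseries_esumT => [|i]; last by rewrite lee_fin sqr_ge0.
have := ell2_normE x; rewrite -/(`|x|).
have : (0 <= \sum_(k <oo) (x k ^+ 2)%:E)%E.
  by apply: nneseries_ge0 => k _ _; rewrite lee_fin sqr_ge0.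
case: (\sum_(k <oo) (x k ^+ 2)%:E)%E => [r| |]//.
  rewrite lee_fin => r0 [xE]; have -> : `|x| = r `^ 2^-1 by exact: xE.
  by rewrite powR12_sqrt// sqr_sqrtr.
by move=> _; rewrite poweRyr// invr_eq0 pnatr_eq0.
Qed.

(* The letters [(i, true)] and [(i, false)] carry the positive and the negative
   part of the coordinate [x i], so that all weights are nonnegative. *)
Definition letter_weight x (t : nat * bool) : R :=
  if t.2 then Num.max (x t.1) 0 else Num.max (- x t.1) 0.

Lemma letter_weight_ge0 x t : 0 <= letter_weight x t.
Proof. by rewrite /letter_weight; case: ifP => _; rewrite le_max lexx orbT. Qed.

Lemma esum_letters (f : nat * bool -> R) : (forall t, 0 <= f t) ->
  \esum_(t in [set: nat * bool]) (f t)%:E =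
  \esum_(i in [set: nat]) (f (i, true) + f (i, false))%:E.
Proof.
move=> f0; have f0' t : (0 <= (f t)%:E)%E by rewrite lee_fin.
transitivity (\esum_(k in [set: nat] `*`` (fun=> [set: bool])) (f (k.1, k.2))%:E).
  rewrite (_ : _ `*`` _ = setT); last by apply/seteqP.
  by apply: eq_esum => -[].
rewrite -(@esum_esum _ _ _ _ _ (fun i c => (f (i, c))%:E)) => [|//].
apply: eq_esum => i _; rewrite (esumID [set true]) => [|//].
have -> : ~` [set true] = [set false].
  by apply/seteqP; split=> -[]//=; case.
by rewrite !setTI !esum_set1.
Qed.

(** Coordinatewise, equal signs contribute [(x i - y i) ^+ 2], while opposite signs contribute
    [x i ^+ 2 + y i ^+ 2], which lies between half of that square and the square itself. *)
Lemma letter_weight_inner x y : exists2 S : R,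
  \esum_(t in [set: nat * bool]) (letter_weight x t * letter_weight y t)%:E = S%:E &
  2^-1 * `|x - y| ^+ 2 <= `|x| ^+ 2 + `|y| ^+ 2 - 2 * S <= `|x - y| ^+ 2.
Proof.
pose s i := letter_weight x (i, true) * letter_weight y (i, true) +
            letter_weight x (i, false) * letter_weight y (i, false).
have w0 z t := letter_weight_ge0 z t.
have s0 i : 0 <= s i by rewrite addr_ge0 ?mulr_ge0.
have bounds i : 2^-1 * (x i - y i) ^+ 2 <= x i ^+ 2 + y i ^+ 2 - 2 * s i <= (x i - y i) ^+ 2.
  have pos (z : R) : 0 <= z -> Num.max z 0 = z /\ Num.max (- z) 0 = 0.
    by move=> z0; split; [exact/max_idPl|apply/max_idPr; rewrite oppr_le0].
  have neg (z : R) : z <= 0 -> Num.max z 0 = 0 /\ Num.max (- z) 0 = - z.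
    by move=> z0; split; [exact/max_idPr|apply/max_idPl; rewrite oppr_ge0].
  rewrite /s /letter_weight /=.
  case/orP: (le_total 0 (x i)) => x0; case/orP: (le_total 0 (y i)) => y0.
  - have [-> ->] := pos _ x0; have [-> ->] := pos _ y0.
    by have ? := sqr_ge0 (x i - y i); apply/andP; split; lra.
  - have [-> ->] := pos _ x0; have [-> ->] := neg _ y0.
    have := mulr_ge0_le0 x0 y0; have := sqr_ge0 (x i + y i).
    by move=> ? ?; apply/andP; split; lra.
  - have [-> ->] := neg _ x0; have [-> ->] := pos _ y0.
    have := mulr_le0_ge0 x0 y0; have := sqr_ge0 (x i + y i).
    by move=> ? ?; apply/andP; split; lra.
  - have [-> ->] := neg _ x0; have [-> ->] := neg _ y0.
    by have ? := sqr_ge0 (x i - y i); apply/andP; split; lra.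
rewrite esum_letters => [|t]; last exact: mulr_ge0.
pose v := \esum_(i in [set: nat]) (s i)%:E;
have xv := @ell2_sqr_cvg x; have yv := @ell2_sqr_cvg y.
(* The lower bound in [bounds] gives [2 * s i <= x i ^+ 2 + y i ^+ 2], which is summable. *)
have vfin : v \is a fin_num.
  rewrite ge0_fin_numE; last by apply: esum_ge0 => i _; rewrite lee_fin.
  have xyv : (fun n => \sum_(i < n) (x i ^+ 2 + y i ^+ 2)) @ \oo --> `|x| ^+ 2 + `|y| ^+ 2.
    under eq_fun do rewrite big_split.
    exact: cvgD.
  apply: (@le_lt_trans _ _ (\esum_(i in [set: nat]) (x i ^+ 2 + y i ^+ 2)%:E)); last first.
    rewrite (cvgn_esum _ xyv) ?ltry// => i.
    by rewrite addr_ge0 ?sqr_ge0.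
  apply: le_esum => i _; rewrite lee_fin; have := bounds i; have := sqr_ge0 (x i - y i).
  have := s0 i; lra.
exists (fine v); first by rewrite fineK.
have sv : (fun n => \sum_(i < n) s i) @ \oo --> fine v.
  by apply: esum_cvgn => //; rewrite fineK.
have Dv : (fun n => \sum_(i < n) (x i ^+ 2 + y i ^+ 2 - 2 * s i)) @ \oo -->
    `|x| ^+ 2 + `|y| ^+ 2 - 2 * fine v.
  under eq_fun do rewrite sumrB big_split -mulr_sumr.
  by apply: cvgB; [exact: cvgD|exact: cvgMl_tmp].
have dv := @ell2_sqr_cvg (x - y).
apply/andP; split.
  apply: (ler_cvg_to (cvgMl_tmp dv) Dv); apply: nearW => n.
  by rewrite mulr_sumr; apply: ler_sum => i _; have /andP[] := bounds i.
apply: (ler_cvg_to Dv dv); apply: nearW => n.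
by apply: ler_sum => i _; have /andP[] := bounds i.
Qed.

(* The exponential vector of [x], with coordinates indexed by the codes of words;
   its square is the Poisson probability. *)
Definition fock x (i : nat) : R :=
  oapp (fun w : seq (nat * bool) => expR (- (`|x| ^+ 2 / 2)) *
    Num.sqrt (size w)`!%:R^-1 * \prod_(t <- w) letter_weight x t) 0 (pickle_inv i).

Lemma fock_ge0 x i : 0 <= fock x i.
Proof.
rewrite /fock; case: pickle_inv => //= w.
rewrite !mulr_ge0 ?expR_ge0 ?sqrtr_ge0// prodr_ge0// => t _.
exact: letter_weight_ge0.
Qed.

(** By [esum_words] the sum over words is the exponential of the inner product [S] of the letter
    weights. With the two normalising factors the exponent becomes minus half the quantity bounded
    in [letter_weight_inner]. *)
Lemma fock_inner x y : exists2 S : R,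
  (fun n => \sum_(i < n) fock x i * fock y i) @ \oo --> S &
  expR (- (`|x - y| ^+ 2 / 2)) <= S <= expR (- (`|x - y| ^+ 2 / 4)).
Proof.
have [S SE /andP[lS uS]] := letter_weight_inner x y.
exists (expR (- ((`|x| ^+ 2 + `|y| ^+ 2 - 2 * S) / 2))); last first.
  by rewrite !ler_expR; apply/andP; split; lra.
have w0 t : 0 <= letter_weight x t * letter_weight y t by rewrite mulr_ge0 ?letter_weight_ge0.
apply: (@esum_cvgn R (fun i => fock x i * fock y i)) => [i|]; first by rewrite mulr_ge0 ?fock_ge0.
pose g w := expR (- (`|x| ^+ 2 / 2)) * expR (- (`|y| ^+ 2 / 2)) *
    ((size w)`!%:R^-1 * \prod_(t <- w) (letter_weight x t * letter_weight y t)).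
have g0 w : 0 <= (size w)`!%:R^-1 * \prod_(t <- w) (letter_weight x t * letter_weight y t) :> R.
  by rewrite mulr_ge0 ?invr_ge0// prodr_ge0.
have E i : fock x i * fock y i = oapp g 0 (pickle_inv i).
  rewrite /fock; case: pickle_inv => [w|]/=; last by rewrite mulr0.
  rewrite /g big_split /=.
  set r := Num.sqrt _; have -> : (size w)`!%:R^-1 = r * r.
    by rewrite -expr2 sqr_sqrtr// invr_ge0.
  by ring.
under eq_esum do rewrite E.
rewrite esum_pickle => [|w]; last by rewrite /g mulr_ge0 ?g0// mulr_ge0 ?expR_ge0.
under eq_esum do rewrite EFinM.
rewrite esumZl ?mulr_ge0 ?expR_ge0// (esum_words w0 SE) -EFinM -!expRD.
by congr (expR _)%:E; field.
Qed.

Lemma fock_weights x : probability_weights (fun i => fock x i ^+ 2).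
Proof.
split=> [i|]; first exact: sqr_ge0.
have [S + /andP[]] := fock_inner x x.
rewrite subrr normr0 expr0n !mul0r oppr0 expR0 => Sc S1 S1'.
have <- : S = 1 by apply/le_anti/andP.
by move: Sc; under eq_fun do under eq_bigr do rewrite -expr2.
Qed.

(** A difference of squares factors, and a weighted arithmetic-geometric mean inequality replaces
    Cauchy-Schwarz; the squared l2 distance of the two vectors is [2 - 2 * S]. *)
Lemma fock_dist x y (d : R) n : 0 < d -> `|x - y| <= d / 2 ->
  \sum_(i < n) `|fock x i ^+ 2 - fock y i ^+ 2| <= d.
Proof.
move=> d0 xyd; have [S Sc /andP[lS _]] := fock_inner x y.
have f0 z i := fock_ge0 z i.
(* For this weight the two resulting terms, [(2 s)^-1 * d ^+ 2 / 4] and [2 s], are both [d / 2]. *)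
set s := d / 4; have s0 : 0 < s by rewrite divr_gt0.
have S1 : 1 - S <= d ^+ 2 / 8.
  have := expR_ge1Dx (- (`|x - y| ^+ 2 / 2)).
  have : `|x - y| ^+ 2 <= (d / 2) ^+ 2 by rewrite lerXn2r ?nnegrE// divr_ge0 ?ltW.
  by lra.
have [x0 xc] := fock_weights x; have [y0 yc] := fock_weights y.
have xs := partial_sum_le n x0 xc; have ys := partial_sum_le n y0 yc.
have Dc : (fun n => \sum_(i < n) (fock x i - fock y i) ^+ 2) @ \oo --> 1 + 1 - 2 * S.
  have -> : (fun n => \sum_(i < n) (fock x i - fock y i) ^+ 2) = (fun n =>
      \sum_(i < n) fock x i ^+ 2 + \sum_(i < n) fock y i ^+ 2 - 2 * \sum_(i < n) fock x i * fock y i).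
    apply/funext => m; rewrite mulr_sumr -big_split -sumrB; apply: eq_bigr => i _ /=.
    by ring.
  by apply: cvgB; [exact: cvgD|exact: cvgMl_tmp].
have Ds := partial_sum_le n (fun i => sqr_ge0 (fock x i - fock y i)) Dc.
have term i : `|fock x i ^+ 2 - fock y i ^+ 2| <=
    (2 * s)^-1 * (fock x i - fock y i) ^+ 2 + s * (fock x i ^+ 2 + fock y i ^+ 2).
  have -> : fock x i ^+ 2 - fock y i ^+ 2 = (fock x i - fock y i) * (fock x i + fock y i).
    by ring.
  rewrite normrM (ger0_norm (addr_ge0 (f0 x i) (f0 y i))).
  have : 0 <= (2 * s)^-1 * (`|fock x i - fock y i| - s * (fock x i + fock y i)) ^+ 2.
    by rewrite mulr_ge0 ?sqr_ge0// invr_ge0 mulr_ge0// ltW.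
  have -> : (fock x i - fock y i) ^+ 2 = `|fock x i - fock y i| ^+ 2 by rewrite real_normK ?num_real.
  set N := `|_|; set Q := fock x i + fock y i.
  have -> : (2 * s)^-1 * (N - s * Q) ^+ 2 = (2 * s)^-1 * N ^+ 2 - N * Q + s / 2 * Q ^+ 2.
    by field; rewrite gt_eqF.
  have : s / 2 * Q ^+ 2 <= s * (fock x i ^+ 2 + fock y i ^+ 2).
    have : 0 <= s / 2 * (fock x i - fock y i) ^+ 2 by rewrite mulr_ge0 ?sqr_ge0// divr_ge0// ltW.
    by rewrite /Q; lra.
  by lra.
apply: (@le_trans _ _ ((2 * s)^-1 * (2 - 2 * S) + s * 2)).
  apply: le_trans (ler_sum _ (fun (i : 'I_n) _ => term i)) _.
  rewrite big_split /= -!mulr_sumr; apply: lerD.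
    by rewrite ler_wpM2l ?invr_ge0 ?mulr_ge0 ?(ltW s0)//; lra.
  by rewrite ler_wpM2l ?(ltW s0)// big_split /=; lra.
have -> : d = (2 * s)^-1 * (2 * (d ^+ 2 / 8)) + s * 2 by rewrite /s; field; rewrite gt_eqF.
by rewrite lerD2r ler_wpM2l ?invr_ge0 ?mulr_ge0 ?(ltW s0)//; lra.
Qed.

(** On either side of [A] the smaller of the two squares is at most the product of the coordinates,
    so both sums are bounded by the affinity [S]. *)
Lemma fock_overlap x y (t : R) : 0 < t -> 2 + 2 / t <= `|x - y| ->
  let A i := fock y i <= fock x i in
  (forall n, \sum_(i < n | ~~ A i) fock x i ^+ 2 <= t) /\
  (forall n, \sum_(i < n | A i) fock y i ^+ 2 <= t).
Proof.
move=> t0 txy A; have [S Sc /andP[_ uS]] := fock_inner x y.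
have f0 z i := fock_ge0 z i.
have St : S <= t.
  (* The crude bound [exp z >= 1 + z] suffices, as [(2 + 2 / t) ^+ 2 / 4] already exceeds
     [1 / t]. *)
  apply: le_trans uS _; rewrite expRN invf_ple ?posrE ?expR_gt0//.
  apply: le_trans _ (expR_ge1Dx _).
  have : (2 + 2 / t) ^+ 2 <= `|x - y| ^+ 2.
    by rewrite lerXn2r ?nnegrE// addr_ge0// divr_ge0// ltW.
  have ti : 0 < t^-1 by rewrite invr_gt0.
  have -> : (2 + 2 / t) ^+ 2 = 4 + 8 * t^-1 + 4 * (t^-1) ^+ 2 by ring.
  have := sqr_ge0 (t^-1); lra.
have Sn n : \sum_(i < n) fock x i * fock y i <= t.
  apply: le_trans (@partial_sum_le R (fun i => fock x i * fock y i) S n _ Sc) St => i.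
  exact: mulr_ge0.
split=> n; apply: le_trans _ (Sn n); rewrite big_mkcond; apply: ler_sum => i _.
  case: ifPn => [|_]; last exact: mulr_ge0.
  by rewrite /A -ltNge => /ltW xy; rewrite expr2 ler_wpM2l.
case: ifPn => [|_]; last exact: mulr_ge0.
by rewrite /A => xy; rewrite expr2 ler_wpM2r.
Qed.

End fock.

(** * Unconditionality constants *)

(* The permutation enumerating the increasing union of the [T k]. *)
Lemma bijection_of_prefixes (T : nat -> seq nat) :
  (forall k, exists s, T k.+1 = T k ++ s) -> (forall k, k <= size (T k))%N ->
  (forall k, perm_eq (T k) (iota 0 (size (T k)))) ->
  exists2 sigma : nat -> nat, bijective sigma &
    forall k i, (i < size (T k))%N -> sigma i = nth 0%N (T k) i.
Proof.
move=> TS Tk Tp.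
have Tle k m : exists s, T (k + m)%N = T k ++ s.
  elim: m => [|m [s IH]]; first by exists [::]; rewrite addn0 cats0.
  by have [s' E] := TS (k + m)%N; exists (s ++ s'); rewrite addnS E IH catA.
have nthT k l i : (i < size (T k))%N -> (i < size (T l))%N -> nth 0%N (T k) i = nth 0%N (T l) i.
  move=> ik il; case/orP: (leq_total k l) => [kl|lk].
    by have [s] := Tle k (l - k)%N; rewrite subnKC// => ->; rewrite nth_cat ik.
  by have [s] := Tle l (k - l)%N; rewrite subnKC// => ->; rewrite nth_cat il.
pose sigma i := nth 0%N (T i.+1) i.
have sigmaE k i : (i < size (T k))%N -> sigma i = nth 0%N (T k) i.
  by move=> ik; apply: nthT => //; exact: Tk.
have uT k : uniq (T k) by rewrite (perm_uniq (Tp k)) iota_uniq.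
have inj : injective sigma.
  move=> i j; pose m := (maxn i j).+1.
  have im : (i < size (T m))%N by apply: leq_trans (Tk m); rewrite ltnS leq_maxl.
  have jm : (j < size (T m))%N by apply: leq_trans (Tk m); rewrite ltnS leq_maxr.
  by rewrite (sigmaE m)// (sigmaE m j)// => /eqP; rewrite nth_uniq// => /eqP.
pose tau j := index j (T j.+1).
have sigma_tau j : sigma (tau j) = j.
  have jT : j \in T j.+1 by rewrite (perm_mem (Tp _)) mem_iota add0n; exact: Tk.
  by rewrite (sigmaE j.+1) ?index_mem// nth_index.
by exists sigma => //; exists tau => // i; apply: inj; rewrite sigma_tau.
Qed.

Section bounded_subsums.
Context {R : realType} {X : normedModType R}.

(** If subsums were unbounded, every tail would contain a finite set with sum of norm at least 1.
    Placing such sets consecutively, with skipped indices filled in between, gives a rearrangement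
    that is not Cauchy. *)
Lemma unconditionally_convergent_bounded (v : nat -> X) : unconditionally_convergent v ->
  exists M : R, forall n (A : pred nat), `|\sum_(i < n | A i) v i| <= M.
Proof.
move=> vU; apply/not_existsP => nb.
have large N : exists s : seq nat, [/\ uniq s, all (leq N) s & 1 <= `|\sum_(i <- s) v i|].
  (* Terms below [N] account for at most [M - 1], so a subsum beyond [M] keeps norm at least 1 after
     they are removed. *)
  pose M := \sum_(i < N) `|v i| + 1.
  have /existsNP[n] := nb M; case/existsNP => A /negP; rewrite -ltNge => MA.
  exists [seq i <- iota 0 n | A i && (N <= i)%N]; split.
  - by rewrite filter_uniq ?iota_uniq.
  - by apply/allP => i; rewrite mem_filter => /andP[/andP[]].
  rewrite big_filter -[n in iota 0 n]subn0 -/(index_iota 0 n) big_mkord.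
  move: MA; rewrite (bigID (fun i : 'I_n => (N <= i)%N)) /= => MA.
  have small : `|\sum_(i < n | A i && ~~ (N <= i)%N) v i| <= \sum_(i < N) `|v i|.
    apply: le_trans (ler_norm_sum _ _ _) _.
    apply: (@le_trans _ _ (\sum_(i < maxn n N | (i < N)%N) `|v i|)).
      rewrite (big_ord_widen_cond (maxn n N) (fun i => A i && ~~ (N <= i)%N)
        (fun i => `|v i|)) ?leq_maxl//.
      rewrite [leLHS]big_mkcond [leRHS]big_mkcond /=; apply: ler_sum => i _.
      by rewrite -ltnNge; case: (A i); case: (i < N)%N; case: (i < n)%N; rewrite /= ?normr_ge0.
    by rewrite -(big_ord_widen (maxn n N) (fun i => `|v i|)) ?leq_maxr.
  by have := ler_normD (\sum_(i < n | A i && (N <= i)%N) v i)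
    (\sum_(i < n | A i && ~~ (N <= i)%N) v i); rewrite /M in MA; lra.
(* From a prefix [T] exhausting an initial segment, [p.1] is the large set and [p.2] the filling
   that exhausts a longer segment. *)
have step T : exists p : seq nat * seq nat, perm_eq T (iota 0 (size T)) ->
    [/\ (0 < size p.1)%N, perm_eq (T ++ p.1 ++ p.2) (iota 0 (size (T ++ p.1 ++ p.2))) &
       1 <= `|\sum_(i <- p.1) v i|].
  have [s [us sN s1]] := large (size T).
  pose N' := (\max_(i <- s) i).+1.
  pose r := [seq i <- iota 0 N' | (i \notin s) && (size T <= i)%N].
  have sN' i : i \in s -> (i < N')%N by move=> si; rewrite ltnS; exact: leq_bigmax_seq.
  exists (s, r) => /= pT.
  have s0 : (0 < size s)%N.
    by rewrite lt0n; apply/eqP => /size0nil s0; move: s1; rewrite s0 big_nil normr0 ler10.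
  split => //.
  have uT : uniq T by rewrite (perm_uniq pT) iota_uniq.
  have mT i : (i \in T) = (i < size T)%N by rewrite (perm_mem pT) mem_iota add0n.
  have TN : (size T <= N')%N.
    have as_ := mem_nth 0%N s0.
    exact: leq_trans (allP sN _ as_) (ltnW (sN' _ as_)).
  have pE : perm_eq (T ++ s ++ r) (iota 0 N').
    apply: uniq_perm; rewrite ?iota_uniq//.
      rewrite !cat_uniq uT us filter_uniq ?iota_uniq// andbT /=; apply/andP; split.
        apply/hasPn => i; rewrite mem_cat mT -leqNgt => /orP[/(allP sN)//|].
        by rewrite mem_filter => /andP[/andP[]].
      by apply/hasPn => i; rewrite mem_filter => /andP[/andP[]].
    move=> i; rewrite !mem_cat mT mem_filter !mem_iota !add0n leq0n /=.
    have [iT|Ti] /= := ltnP i (size T); first by rewrite (leq_trans iT).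
    case: (boolP (i \in s)) => [/sN' ->//|_] /=.
    by rewrite ?andbT.
  by rewrite (perm_size pE) size_iota.
have [F HF] := choice step.
pose T := fix T k := if k is k'.+1 then T k' ++ (F (T k')).1 ++ (F (T k')).2 else [::].
have Tp k : perm_eq (T k) (iota 0 (size (T k))).
  by elim: k => //= k IH; have [] := HF _ IH.
have Tk k : (k <= size (T k))%N.
  elim: k => //= k IH; rewrite !size_cat; have [s0 _ _] := HF _ (Tp k).
  by rewrite addnA -addn1; exact: leq_trans (leq_add IH s0) (leq_addr _ _).
have TS k : exists s, T k.+1 = T k ++ s by eexists.
have [sigma bs sigmaE] := bijection_of_prefixes TS Tk Tp.
have := vU _ bs; move=> /cvg_ex[l /= vl].
(* Two late partial sums lie within 1/2 of the limit although a large block separates them. *)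
have [|N _ HN] := (cvgrPdist_lt _ _).1 vl 2^-1; first by rewrite invr_gt0.
pose n := size (T N); pose s := (F (T N)).1.
have [_ _ s1] := HF _ (Tp N).
have ser m : (m <= size (T N.+1))%N ->
    series (v \o sigma) m = \sum_(i <- take m (T N.+1)) v i.
  move=> mT; rewrite /series /= [RHS](big_nth 0%N) size_take_min (minn_idPl mT).
  rewrite big_nat_cond [RHS]big_nat_cond; apply: eq_bigr => i /andP[/andP[_ im] _].
  by rewrite nth_take//= (sigmaE N.+1)//; exact: leq_trans mT.
have sz : size (T N.+1) = (n + (size s + size (F (T N)).2))%N by rewrite /= !size_cat.
have E1 : series (v \o sigma) n = \sum_(i <- T N) v i.
  by rewrite ser ?sz ?leq_addr//= take_size_cat.
have E2 : series (v \o sigma) (n + size s) = \sum_(i <- T N) v i + \sum_(i <- s) v i.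
  by rewrite ser ?sz ?leq_add2l ?leq_addr//= catA take_size_cat ?size_cat// big_cat.
have d1 := HN n (Tk N).
have d2 := HN (n + size s)%N (leq_trans (Tk N) (leq_addr _ _)).
have := ler_normB (l - series (v \o sigma) n) (l - series (v \o sigma) (n + size s)).
move: d1 d2; rewrite E1 E2 => d1 d2.
rewrite (_ : _ - _ = \sum_(i <- s) v i); first by lra.
by rewrite opprB (addrC (l - _)) addrA subrK addrAC subrr add0r.
Qed.

End bounded_subsums.

(** * Uniform boundedness of the basis projections *)

Section coefficients.
Context {R : realType} {X : completeNormedModType R}.
Variables (e : nat -> X) (coef : X -> nat -> R).
Implicit Types (x y z : X) (a : nat -> R) (n : nat) (A : pred nat).
Hypothesis coefP : forall x, (fun n => \sum_(i < n) coef x i *: e i) @ \oo --> x.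
Hypothesis coefU : forall x a, (fun n => \sum_(i < n) a i *: e i) @ \oo --> x -> a = coef x.

Definition proj n A x := \sum_(i < n | A i) coef x i *: e i.

Definition proj_bounded (B : R) x := forall n A, `|proj n A x| <= B.

Lemma coefB x y i : coef (x - y) i = coef x i - coef y i.
Proof.
rewrite -(@coefU (x - y) (fun i => coef x i - coef y i))//.
under eq_fun do under eq_bigr do rewrite scalerBl.
by under eq_fun do rewrite sumrB; apply: cvgB; exact: coefP.
Qed.

Lemma coefZ (c : R) x i : coef (c *: x) i = c * coef x i.
Proof.
rewrite -(@coefU (c *: x) (fun i => c * coef x i))//.
under eq_fun do under eq_bigr do rewrite -scalerA.
by under eq_fun do rewrite -scaler_sumr; apply: cvgZl_tmp; exact: coefP.
Qed.

Lemma projB n A x y : proj n A (x - y) = proj n A x - proj n A y.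
Proof. by rewrite /proj -sumrB; apply: eq_bigr => i _; rewrite coefB scalerBl. Qed.

Lemma projZ n A c x : proj n A (c *: x) = c *: proj n A x.
Proof. by rewrite /proj scaler_sumr; apply: eq_bigr => i _; rewrite coefZ scalerA. Qed.

Lemma proj_boundedB B B' x y :
  proj_bounded B x -> proj_bounded B' y -> proj_bounded (B + B') (x - y).
Proof.
move=> xB yB n A; rewrite projB; apply: le_trans (ler_normB _ _) _.
by rewrite lerD.
Qed.

Lemma proj_boundedZ B c x : proj_bounded B x -> proj_bounded (`|c| * B) (c *: x).
Proof. by move=> xB n A; rewrite projZ normrZ ler_wpM2l. Qed.

Lemma coef_finite_sum a n i :
  coef (\sum_(i < n) a i *: e i) i = if (i < n)%N then a i else 0.
Proof.
rewrite -(@coefU _ (fun i => if (i < n)%N then a i else 0))//.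
apply/cvgrPdist_lt => d d0; exists n => // m /= nm.
rewrite (big_ord_widen m (fun i => a i *: e i))// big_mkcond /=.
rewrite -sumrB big1 ?normr0// => k _; case: ifP => _; first by rewrite subrr.
by rewrite scale0r subr0.
Qed.

Lemma coef0 i : coef 0 i = 0.
Proof. by have := coef_finite_sum (fun=> 0) 0 i; rewrite big_ord0. Qed.

Lemma basis_neq0 i : e i != 0.
Proof.
apply/eqP => ei0; have := coef_finite_sum (fun j => (j == i)%:R) i.+1 i.
rewrite big1 => [|j _]; first by rewrite coef0 ltnSn eqxx => /esym/eqP; rewrite oner_eq0.
by case: eqP => [->|_]; rewrite ?ei0 ?scaler0 ?scale0r.
Qed.

(* Completeness of the norm [x |-> sup_{n, A} `|proj n A x|]. *)
Lemma proj_bounded_limit (s : nat -> X) x (eta : nat -> R) :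
  s @ \oo --> x -> eta @ \oo --> 0 ->
  (forall k m, proj_bounded (eta k) (s (k + m)%N - s k)) ->
  forall k, proj_bounded (eta k) (x - s k).
Proof.
move=> sx eta0 sC.
(* The projection onto the single index [i] shows that each coefficient sequence is Cauchy, as [e i]
   is nonzero. *)
have cvc i : cvgn (fun k => coef (s k) i).
  apply: (@cvgn_of_cauchy R (R : completeNormedModType R)) => d d0.
  have ei : 0 < `|e i| by rewrite normr_gt0 basis_neq0.
  have de : 0 < d * `|e i| by rewrite mulr_gt0.
  have [N _ HN] := (cvgrPdist_lt _ _).1 eta0 _ de.
  exists N => n m Nn nm; have := sC n (m - n)%N i.+1 (pred1 i).
  rewrite subnKC// /proj (big_pred1 ord_max) => [|j]; last by rewrite /= -val_eqE.
  rewrite coefB normrZ distrC => le.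
  rewrite -(ler_pM2r ei); apply: le_trans le _.
  have := HN n Nn; rewrite sub0r normrN => /ltW; apply: le_trans; exact: ler_norm.
pose b i := limn (fun k => coef (s k) i).
have pb n A : (fun k => proj n A (s k)) @ \oo --> \sum_(i < n | A i) b i *: e i.
  by apply: cvg_big => [|i _]; [exact: add_continuous|apply: cvgZr_tmp; exact: cvc].
have bd k n A : `|\sum_(i < n | A i) b i *: e i - proj n A (s k)| <= eta k.
  apply: (@norm_cvgn_le _ _ (fun l => proj n A (s l) - proj n A (s k))).
    by apply: cvgB; [exact: pb|exact: cvg_cst].
  by exists k => // l /= kl; rewrite -projB -(subnKC kl); exact: sC.
(* A three-epsilon argument shows that the limit coefficients expand [x]; uniqueness of expansions
   concludes. *)
have bx : b = coef x.
  apply: coefU; apply/cvgrPdist_lt => d d0; have d3 : 0 < d / 3 by rewrite divr_gt0.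
  have [N1 _ H1] := (cvgrPdist_lt _ _).1 eta0 _ d3.
  have [N2 _ H2] := (cvgrPdist_lt _ _).1 sx _ d3.
  pose k := maxn N1 N2.
  have h1 : eta k < d / 3.
    have := H1 k (leq_maxl _ _); rewrite sub0r normrN; apply: le_lt_trans; exact: ler_norm.
  have h2 : `|x - s k| < d / 3 by exact: H2 k (leq_maxr _ _).
  have [N _ H] := (cvgrPdist_lt _ _).1 (@coefP (s k)) _ d3.
  exists N => // n /= Nn; have h3 := H n Nn.
  have h4 := bd k n xpredT.
  rewrite -(subrKA (s k) x) -(subrKA (proj n xpredT (s k)) (s k)).
  have := ler_normD (x - s k) (s k - proj n xpredT (s k) + (proj n xpredT (s k) - \sum_(i < n) b i *: e i)).
  have := ler_normD (s k - proj n xpredT (s k)) (proj n xpredT (s k) - \sum_(i < n) b i *: e i).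
  rewrite (distrC (proj _ _ _)); move: h3 h4; rewrite /= -/(proj n xpredT (s k)) => h3 h4.
  by move=> ? ?; lra.
by move=> k n A; rewrite projB {1}/proj -bx.
Qed.

Hypothesis bounded : forall x, exists B, proj_bounded B x.

(** Baire: the sets of vectors bounded by [m] cover the space, so the closure of one of them
    contains a ball. *)
Lemma proj_bounded_somewhere_dense : exists (m : nat) (x0 : X) (r : R), 0 < r /\
  forall z, `|z| < r -> forall d : R, 0 < d ->
    exists2 w, `|x0 + z - w| < d & proj_bounded m%:R w.
Proof.
pose S (m : nat) := [set x | proj_bounded m%:R x].
have [m ndense] : exists m, ~ dense (~` closure (S m)).
  apply/not_existsP => H.
  have /Baire : forall m, open (~` closure (S m)) /\ dense (~` closure (S m)).
    move=> m; split; first exact/closed_openC/closed_closure.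
    by apply: contrapT; exact: H.
  move=> /(_ setT) [||x [_ xF]]; [by exists 0|exact: openT|].
  have [B xB] := bounded x.
  have Bm : B <= (Num.bound `|B|)%:R.
    by apply: le_trans (ler_norm _) _; apply/ltW; exact: archi_boundP.
  apply: (xF (Num.bound `|B|)) => //; apply: subset_closure => n A.
  exact: le_trans (xB n A) Bm.
have [V [x0 Vx0] [oV VS]] : exists2 V, V !=set0 & open V /\ V `&` ~` closure (S m) = set0.
  apply: contrapT => H; apply: ndense => V V0 oV; apply: contrapT => /set0P/negP.
  by rewrite negbK => /eqP VS; apply: H; exists V.
have /nbhs_ballP[r /= r0 rV] : nbhs x0 V by exact: open_nbhs_nbhs.
exists m, x0, r; split=> // z zr d d0.
have : closure (S m) (x0 + z).
  apply: contrapT => nc; have : (V `&` ~` closure (S m)) (x0 + z); last by rewrite VS.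
  by split=> //; apply: rV; rewrite -ball_normE /= opprD addrA subrr sub0r normrN.
move=> /(_ _ (nbhsx_ballx _ _ d0))[w [Sw]]; rewrite -ball_normE /= => wd.
by exists w.
Qed.

(** Subtracting approximants of [x0 + t *: z] and of [x0] moves the ball to the origin; rescaling
    reaches every [z]. *)
Lemma proj_bounded_approx : exists2 C : R, 0 <= C &
  forall z, exists2 w, `|z - w| <= `|z| / 2 & proj_bounded (C * `|z|) w.
Proof.
have [m [x0 [r [r0 H]]]] := proj_bounded_somewhere_dense.
exists (4 * m%:R / r); first by rewrite divr_ge0 ?mulr_ge0 ?(ltW r0).
move=> z; have [->|z0] := eqVneq z 0.
  exists 0; first by rewrite subrr normr0 mul0r.
  by move=> n A; rewrite normr0 mulr0 /proj big1 ?normr0// => i _; rewrite coef0 scale0r.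
have nz : 0 < `|z| by rewrite normr_gt0.
(* [t *: z] has norm [r / 2]; two errors [r / 8] add up to half of it, and [2 m / t] is [4 m / r]
   times the norm of [z]. *)
pose t := r / (2 * `|z|); have t0 : 0 < t by rewrite divr_gt0// mulr_gt0.
have tz : `|t *: z| < r.
  rewrite normrZ gtr0_norm// /t mulrAC ltr_pdivrMr ?mulr_gt0// ltr_pM2l//.
  by rewrite ltr_pMl// ltr1n.
have r8 : 0 < r / 8 by rewrite divr_gt0.
have [p pz pB] := H _ tz _ r8.
have [p' p'z p'B] := H 0 ltac:(by rewrite normr0) _ r8.
rewrite addr0 in p'z.
exists (t^-1 *: (p - p')).
  have -> : z - t^-1 *: (p - p') = t^-1 *: ((x0 + t *: z - p) - (x0 - p')).
    have -> : x0 + t *: z - p - (x0 - p') = t *: z - (p - p').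
      by rewrite !opprB (addrC p' (- x0)) addrA -(addrA x0) (addrC x0) addrK -addrA (addrC (- p)).
    by rewrite [RHS]scalerBr scalerA mulVf ?gt_eqF// scale1r.
  rewrite normrZ gtr0_norm ?invr_gt0// ler_pdivrMl//.
  apply: le_trans (ler_normB _ _) _.
  have -> : t * (`|z| / 2) = r / 4 by rewrite /t; field; rewrite gt_eqF.
  by lra.
have := proj_boundedZ t^-1 (proj_boundedB pB p'B).
rewrite gtr0_norm ?invr_gt0//; congr (proj_bounded _ _).
by rewrite /t; field; rewrite !gt_eqF.
Qed.

(* As in the open mapping theorem: sum a geometric series of approximants. *)
Lemma proj_uniformly_bounded : exists2 K : R, 0 <= K & forall x, proj_bounded (K * `|x|) x.
Proof.
have [C C0 H] := proj_bounded_approx.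
have H' z : exists w, `|z - w| <= `|z| / 2 /\ proj_bounded (C * `|z|) w.
  by have [w] := H z; exists w.
have [W HW] := choice H'.
exists (2 * C); first by rewrite mulr_ge0.
move=> x; pose z k := iter k (fun y => y - W y) x.
have zS k : z k.+1 = z k - W (z k) by [].
have zk k : `|z k| <= `|x| * 2^-1 ^+ k.
  elim: k => [|k IH]; first by rewrite expr0 mulr1.
  rewrite zS exprSr mulrA; apply: le_trans (HW (z k)).1 _.
  by rewrite ler_pM2r ?invr_gt0.
have geo : (fun k => `|x| * 2^-1 ^+ k) @ \oo --> (0 : R).
  rewrite -(mulr0 `|x|); apply: cvgMl_tmp; apply: cvg_expr.
  by rewrite ger0_norm ?invr_ge0// invf_lt1 ?ltr1n.
(* This is the sum from [k] on of the bounds [C * |x| / 2 ^ j] of the successive approximants. *)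
pose eta k := 2 * C * (`|x| * 2^-1 ^+ k).
have etac : eta @ \oo --> 0 by rewrite -(mulr0 (2 * C)); exact: cvgMl_tmp.
have sx : (fun k => x - z k) @ \oo --> x.
  apply/cvgrPdist_lt => d d0; have [N _ HN] := (cvgrPdist_lt _ _).1 geo _ d0.
  exists N => // k /HN /=; rewrite sub0r normrN opprB addrC subrK => lt.
  by apply: le_lt_trans (zk k) _; apply: le_lt_trans lt; exact: ler_norm.
have bd k m : proj_bounded (2 * C * (`|x| * (2^-1 ^+ k - 2^-1 ^+ (k + m)))) (z k - z (k + m)%N).
  elim: m => [|m IH].
    move=> n A; rewrite addn0 !subrr !mulr0 /proj big1 ?normr0// => i _.
    by rewrite coef0 scale0r.
  rewrite addnS zS opprB addrA addrAC.
  have := proj_boundedB IH (proj_boundedZ (-1) (HW (z (k + m)%N)).2).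
  rewrite normrN1 mul1r scaleN1r opprK => h n A; apply: le_trans (h n A) _.
  have := ler_wpM2l C0 (zk (k + m)%N).
  rewrite exprSr; lra.
have := @proj_bounded_limit (fun k => x - z k) x eta sx etac _ 0%N.
rewrite /eta subrr subr0 expr0 mulr1; apply => k m n A.
rewrite opprB addrC addrA subrK; apply: le_trans (bd k m n A) _.
rewrite ler_wpM2l ?mulr_ge0// ler_wpM2l// gerBl; exact: exprn_ge0.
Qed.

End coefficients.

Section multipliers.
Context {R : realType} {X : normedModType R}.

(* The norm is convex in each [theta i], hence maximal at an extreme point of the cube. *)
Lemma norm_sum_le_vertices (v : nat -> X) (M : R) n (w : X) (theta : nat -> R) :
  (forall A : pred nat, `|w + \sum_(i < n | A i) v i| <= M) ->
  (forall i, 0 <= theta i <= 1) -> `|w + \sum_(i < n) theta i *: v i| <= M.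
Proof.
move=> H th; elim: n w H => [|n IH] w H.
  by have := H xpredT; rewrite !big_ord0.
rewrite big_ord_recr /=.
set S := \sum_(i < n) _; set t := theta n.
have [t0 t1] : 0 <= t /\ t <= 1 by have /andP[] := th n.
have -> : w + (S + t *: v n) = (1 - t) *: (w + S) + t *: (w + v n + S).
  by rewrite addrA [w + v n + S]addrAC (scalerDr t) [RHS]addrA -scalerDl subrK scale1r.
have h0 : `|w + S| <= M.
  apply: IH => A; have := H (fun i => (i < n)%N && A i).
  rewrite big_mkcond big_ord_recr /= ltnn addr0 -big_mkcond /=.
  by congr (`|_ + _| <= _); apply: eq_bigl => i; rewrite ltn_ord.
have h1 : `|w + v n + S| <= M.
  apply: IH => A; have := H (fun i => (i == n) || A i).
  rewrite big_mkcond big_ord_recr /= eqxx -big_mkcond /=.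
  rewrite [\sum_(i < n | _) _ + _]addrC addrA.
  by congr (`|_ + _| <= _); apply: eq_bigl => i; rewrite ltn_eqF.
apply: le_trans (ler_normD _ _) _.
rewrite !normrZ ger0_norm ?subr_ge0// (ger0_norm t0).
have -> : M = (1 - t) * M + t * M by ring.
by rewrite lerD ?ler_wpM2l ?subr_ge0.
Qed.

(** The positive and the negative part of [theta] each take values in [0, 1], whence the factor
    2. *)
Lemma norm_sum_le_multipliers (v : nat -> X) (M : R) n (theta : nat -> R) :
  (forall A : pred nat, `|\sum_(i < n | A i) v i| <= M) ->
  (forall i, `|theta i| <= 1) -> `|\sum_(i < n) theta i *: v i| <= 2 * M.
Proof.
move=> H th; have bnd (t : nat -> R) : (forall i, 0 <= t i <= 1) -> `|\sum_(i < n) t i *: v i| <= M.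
  by move=> t01; rewrite -[X in `|X|]add0r; apply: norm_sum_le_vertices => // A; rewrite add0r.
have -> : \sum_(i < n) theta i *: v i =
    \sum_(i < n) Num.max (theta i) 0 *: v i - \sum_(i < n) Num.max (- theta i) 0 *: v i.
  rewrite -sumrB; apply: eq_bigr => i _; rewrite -scalerBl; congr (_ *: _).
  case/orP: (le_total 0 (theta i)) => ti.
    by rewrite (max_idPl _)// (max_idPr _) ?oppr_le0// subr0.
  by rewrite (max_idPr _)// (max_idPl _) ?oppr_ge0// sub0r opprK.
have thP i := ler_normlP _ _ (th i).
rewrite mulr_natl mulr2n; apply: le_trans (ler_normB _ _) _; apply: lerD.
  apply: (bnd (fun i => Num.max (theta i) 0)) => i; have [_ b] := thP i.
  by rewrite le_max lexx orbT/= ge_max b ler01.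
apply: (bnd (fun i => Num.max (- theta i) 0)) => i; have [b _] := thP i.
by rewrite le_max lexx orbT/= ge_max ler01 andbT.
Qed.

Lemma reindex_injective (I : finType) (f : I -> nat) (e : nat -> X) (g : I -> R) n :
  injective f -> (forall i, f i < n)%N ->
  \sum_i g i *: e (f i) = \sum_(j < n) oapp g 0 [pick i | f i == j] *: e j.
Proof.
move=> finj fn.
have E (j : 'I_n) : oapp g 0 [pick i | f i == j] *: e j = \sum_(i | f i == j) g i *: e (f i).
  case: pickP => [i /eqP fi|nof] /=.
    by rewrite (big_pred1 i) ?fi// => k /=; rewrite -fi (inj_eq finj).
  by rewrite scale0r big_pred0.
rewrite (eq_bigr _ (fun j _ => E j)) (exchange_big_dep xpredT)//=.
by apply: eq_bigr => i _; rewrite (big_pred1 (Ordinal (fn i))).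
Qed.

End multipliers.

Lemma unconditional_basis_with {R : realType} {X : completeNormedModType R} (e : nat -> X) :
  unconditional_basis e ->
  (forall i, e i != 0) /\ exists2 K : R, 0 < K & unconditional_with K e.
Proof.
move=> [eB eU].
have serE (a : nat -> R) : series (fun n => a n *: e n) = (fun n => \sum_(i < n) a i *: e i).
  by apply/funext => n; rewrite /series /= big_mkord.
have [coef coefH] := choice eB.
have coefP x : (fun n => \sum_(i < n) coef x i *: e i) @ \oo --> x.
  by have [+ _] := coefH x; rewrite serE.
have coefU x (a : nat -> R) : (fun n => \sum_(i < n) a i *: e i) @ \oo --> x -> a = coef x.
  by have [_ u] := coefH x; rewrite -serE => /u.
have bounded (x : X) : exists B, proj_bounded e coef B x.
  have [M HM] := unconditionally_convergent_bounded (eU _ _ (coefH x).1).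
  by exists M.
have [K K0 HK] := proj_uniformly_bounded coefP coefU bounded.
split; first exact: basis_neq0 coefU.
(* The 2 comes from signed multipliers; the 1 makes the constant positive. *)
exists (2 * K + 1); first by rewrite ltr_wpDl// mulr_ge0.
move=> I f finj a theta th.
pose n := (\max_i f i).+1.
have fn i : (f i < n)%N by rewrite ltnS; exact: leq_bigmax.
rewrite !(reindex_injective e _ finj fn).
pose a' j := oapp a 0 [pick i | f i == j].
pose th' j := oapp theta 0 [pick i | f i == j].
have -> : \sum_(j < n) oapp (fun i => theta i * a i) 0 [pick i | f i == j] *: e j =
    \sum_(j < n) th' j *: (a' j *: e j).
  apply: eq_bigr => j _; rewrite scalerA /a' /th'.
  by case: pickP => //= _; rewrite mul0r.
apply: (@le_trans _ _ (2 * (K * `|\sum_(j < n) a' j *: e j|))); last first.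
  by rewrite [leRHS]mulrDl mul1r mulrA lerDl.
apply: (norm_sum_le_multipliers (v := fun j => a' j *: e j)) => [A|j]; last first.
  by rewrite /th'; case: pickP => /= [i _|_]; rewrite ?normr0.
have := HK (\sum_(j < n) a' j *: e j) n A.
rewrite /proj; congr (`|_| <= _); apply: eq_bigr => j _.
by rewrite (coef_finite_sum coefU) ltn_ord.
Qed.

(** * Block maps and their sum *)

(** Cotype is applied to the partial sums over the colours. Changing their signs costs at most [K]
    by unconditionality, so the Rademacher average is controlled by the norm of the whole sum. *)
Lemma cotype_lower_estimate {R : realType} {X : normedModType R} (u : nat -> X) (q K : R) :
  1 <= q -> 0 < K -> unconditional_with K u -> has_cotype X q ->
  exists2 D : R, 0 < D & lower_estimate u q D.
Proof.
move=> q1 K0 uK [C C0 HC]; have q0 : 0 < q by exact: lt_le_trans q1.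
have qK (z : R) : 0 <= z -> z `^ q^-1 `^ q = z.
  by move=> z0; rewrite -powRrM mulVf ?gt_eqF// powRr1.
have Kq (z : R) : 0 <= z -> z `^ q `^ q^-1 = z.
  by move=> z0; rewrite -powRrM mulfV ?gt_eqF// powRr1.
exists ((C * K) `^ q); first by rewrite powR_gt0// mulr_gt0.
move=> n c [m chi].
pose x (j : 'I_m) := \sum_(i < n | chi i == j) c i *: u i.
set N := `|\sum_(i < n) c i *: u i|; have N0 : 0 <= N by exact: normr_ge0.
have signs (eps : {ffun 'I_m -> bool}) : `|\sum_(j < m) (-1) ^+ eps j *: x j| <= K * N.
  (* The sum has one term, the sign of the colour of [i], or is empty and 0 if that colour is
     dropped. *)
  pose theta (i : 'I_n) : R := \sum_(j < m | chi i == j) (-1) ^+ eps j.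
  have -> : \sum_(j < m) (-1) ^+ eps j *: x j = \sum_(i < n) (theta i * c i) *: u i.
    under eq_bigr do rewrite scaler_sumr big_mkcond /=.
    rewrite exchange_big /=; apply: eq_bigr => i _.
    rewrite mulr_suml scaler_suml [RHS]big_mkcond /=; apply: eq_bigr => j _.
    by case: ifP => // _; rewrite scalerA.
  apply: (uK _ val val_inj (fun i : 'I_n => c i)) => i; rewrite /theta.
  have [ltm|gem] := ltnP (chi i) m.
    rewrite (big_pred1 (Ordinal ltm)) => [|j]; last by rewrite /= -val_eqE eq_sym.
    by rewrite normrX normrN1 expr1n.
  by rewrite big_pred0 ?normr0// => j; apply: gtn_eqF; exact: leq_trans gem.
have rad : rademacher_moment q x <= (K * N) `^ q.
  rewrite /rademacher_moment ler_pdivrMr ?exprn_gt0//.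
  apply: (@le_trans _ _ (\sum_(eps : {ffun 'I_m -> bool}) (K * N) `^ q)).
    apply: ler_sum => eps _; apply: ge0_ler_powR (signs eps).
    - exact: ltW.
    - by rewrite nnegrE.
    - by rewrite nnegrE mulr_ge0// ltW.
  by rewrite sumr_const card_ffun card_bool card_ord -[leLHS]mulr_natr natrX.
have rad0 : 0 <= rademacher_moment q x.
  by rewrite divr_ge0 ?exprn_ge0// sumr_ge0// => eps _; exact: powR_ge0.
have S0 : 0 <= \sum_(j < m) `|x j| `^ q by apply: sumr_ge0 => j _; exact: powR_ge0.
rewrite /coloring_sum /= -(qK _ S0) -powRM ?mulr_ge0 ?(ltW C0) ?(ltW K0)//.
rewrite ge0_ler_powR ?nnegrE ?powR_ge0 ?(ltW q0) ?mulr_ge0 ?(ltW C0) ?(ltW K0)//.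
apply: le_trans (HC m x) _; rewrite -mulrA ler_pM2l//.
rewrite -[leRHS]Kq ?mulr_ge0 ?(ltW K0)//.
by rewrite ge0_ler_powR ?nnegrE ?powR_ge0 ?invr_ge0 ?(ltW q0).
Qed.

Section span_closure.
Context {R : realType} {X : normedModType R}.
Implicit Types (u : nat -> X) (v w : X).

(** The coefficients may vary with [n], as they do for limits of near maximisers. *)
Definition span_closure u v : Prop :=
  exists c : nat -> nat -> R, (fun n => \sum_(i < n) c n i *: u i) @ \oo --> v.

Lemma span_closureB u v w : span_closure u v -> span_closure u w -> span_closure u (v - w).
Proof.
move=> [c cv] [d dw]; exists (fun n i => c n i - d n i).
under eq_fun do under eq_bigr do rewrite scalerBl.
by under eq_fun do rewrite sumrB; apply: cvgB.
Qed.

Lemma span_closureZ u v (r : R) : span_closure u v -> span_closure u (r *: v).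
Proof.
move=> [c cv]; exists (fun n i => r * c n i).
under eq_fun do under eq_bigr do rewrite -scalerA.
by under eq_fun do rewrite -scaler_sumr; apply: cvgZl_tmp.
Qed.

(** On finite approximants, the passage to block [k] is a 0-1 multiplier on a rectangle of indices;
    the bound survives the limit. *)
Lemma span_closure_component (g : nat * nat -> X) (K : R) (v : nat -> X) k m :
  0 <= K -> unconditional_with K g -> (forall k, span_closure (fun i => g (k, i)) (v k)) ->
  (k < m)%N -> `|v k| <= K * `|\sum_(j < m) v j|.
Proof.
move=> K0 gK vs km; have [c cv] := choice vs.
have sumv : (fun n => \sum_(j < m) \sum_(i < n) c j n i *: g (j : nat, i : nat)) @ \oo -->
    \sum_(j < m) v j.
  apply: cvg_big => [|j _]; first exact: add_continuous.
  exact: (cv j).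
apply: (ler_cvg_to (cvg_norm (cv k)) (cvgMl_tmp (cvg_norm sumv))).
apply: nearW => n; rewrite pair_big /=.
have finj : injective (fun p : 'I_m * 'I_n => (val p.1, val p.2)).
  by move=> [a b] [a' b'] [/val_inj -> /val_inj ->].
pose theta (p : 'I_m * 'I_n) : R := (p.1 == Ordinal km)%:R.
have th p : `|theta p| <= 1 by rewrite /theta; case: (_ == _); rewrite ?normr1 ?normr0.
have := gK _ _ finj (fun p => c p.1 n p.2) theta th.
congr (`|_| <= _).
rewrite -(pair_big xpredT xpredT (fun (j : 'I_m) (i : 'I_n) =>
  (theta (j, i) * c j n i) *: g (j : nat, i : nat))) /=.
rewrite (bigD1 (Ordinal km))//= [X in _ + X]big1 ?addr0 => [|j jk].
  by apply: eq_bigr => i _; rewrite /theta /= eqxx mul1r.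
by rewrite big1// => i _; rewrite /theta /= (negPf jk) mul0r scale0r.
Qed.

End span_closure.

Section block_map.
Context {R : realType} {X : completeNormedModType R}.

(** The Poisson probability of [x] is fed to [simplex_embedding]: [fock_dist] gives uniform
    continuity and [fock_overlap] separation. *)
Lemma block_map (u : nat -> X) (q K : R) :
  1 <= q -> 0 < K -> unconditional_with K u -> has_cotype X q -> (forall i, `|u i| = 1) ->
  exists psi : ell2 R -> X, [/\
    forall x, `|psi x| <= 1,
    forall x, span_closure u (psi x),
    forall w : R, 0 < w -> exists2 d : R, 0 < d &
      forall x y, `|x - y| <= d -> `|psi x - psi y| <= w &
    exists2 c : R, 0 < c & exists2 t : R, 0 < t &
      forall x y, t <= `|x - y| -> c <= `|psi x - psi y|].
Proof.
move=> q1 K0 uK Xq u1.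
have [D D0 lowD] := cotype_lower_estimate q1 K0 uK Xq.
have [phi phiP [phiC [c c0 [t t0 phiS]]]] := simplex_embedding q1 lowD u1 D0 K0 uK.
exists (fun x => phi (fun i => fock x i ^+ 2)); split.
- by move=> x; have [] := phiP _ (@fock_weights R x).
- by move=> x; have [] := phiP _ (@fock_weights R x).
- move=> w w0; have [d d0 H] := phiC w w0.
  exists (d / 2); first by rewrite divr_gt0.
  move=> x y xy; apply: (H _ _ (@fock_weights R x) (@fock_weights R y)) => n.
  exact: fock_dist.
- exists c => //; exists (2 + 2 / t); first by rewrite addr_gt0// divr_gt0.
  move=> x y xy; have [A B] := fock_overlap t0 xy.
  exact: (phiS _ _ (fun i => fock y i <= fock x i) (@fock_weights R x) (@fock_weights R y) A B).
Qed.

End block_map.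

(** * Moduli and pointwise estimates *)

Section moduli_bounds.
Context {R : realType} {V W : normedModType R}.
Implicit Types (f : V -> W).

Lemma omega_le f (t B : R) :
  (forall x y, `|x - y| <= t -> `|f x - f y| <= B) -> (omega f t <= B%:E)%E.
Proof. by move=> H; apply: ge_ereal_sup => _ [[x y] /= xy <-]; rewrite lee_fin H. Qed.

Lemma omega_ge0 f (t : R) : 0 <= t -> (0 <= omega f t)%E.
Proof.
move=> t0; apply: ereal_sup_ubound; exists (0, 0) => /=; rewrite subrr normr0//.
Qed.

Lemma rho_ge f (t B : R) :
  (forall x y, t <= `|x - y| -> B <= `|f x - f y|) -> (B%:E <= rho f t)%E.
Proof. by move=> H; apply: le_ereal_inf_tmp => _ [[x y] /= xy <-]; rewrite lee_fin H. Qed.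

Lemma coarse_uniform_embedding f :
  (forall t, exists B : R, forall x y, `|x - y| <= t -> `|f x - f y| <= B) ->
  (forall e : R, 0 < e -> exists2 d : R, 0 < d &
     forall x y, `|x - y| <= d -> `|f x - f y| <= e) ->
  (forall B : R, exists t : R, forall x y, t <= `|x - y| -> B <= `|f x - f y|) ->
  (forall t : R, 0 < t -> exists2 c : R, 0 < c &
     forall x y, t <= `|x - y| -> c <= `|f x - f y|) ->
  coarse_embedding f /\ uniform_embedding f.
Proof.
move=> fC fU fE fS; split; split.
- move=> t _; have [B HB] := fC t.
  by apply: le_lt_trans (omega_le HB) _; exact: ltry.
- apply/cvgeyPge => B; have [t Ht] := fE B.
  exists t; split; first exact: num_real.
  move=> s /= ts; apply: rho_ge => x y sxy; apply: Ht; exact: le_trans (ltW ts) sxy.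
- have near_bound (e : R) : 0 < e -> \forall t \near 0^'+, (0 <= omega f t <= e%:E)%E.
    move=> e0; have [d d0 Hd] := fU e e0.
    near=> t; rewrite omega_ge0//=; apply: omega_le => x y xy; apply: Hd.
    by apply: le_trans xy _; near: t; exact: nbhs_right_le.
  (* [omega] is extended-real, so finiteness near 0 accompanies the convergence of its real part. *)
  apply/fine_cvgP; split.
    have := near_bound 1 ltr01; apply: filterS => t /andP[w0 w1].
    by rewrite ge0_fin_numE// (le_lt_trans w1)// ltry.
  apply/cvgrPdist_le => e e0; have := near_bound e e0; apply: filterS => t /andP[w0 w1].
  rewrite /= sub0r normrN ger0_norm ?fine_ge0// -lee_fin fineK//.
  by rewrite ge0_fin_numE// (le_lt_trans w1)// ltry.
- move=> t t0; have [c c0 Hc] := fS t t0.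
  by apply: lt_le_trans (rho_ge Hc); rewrite lte_fin.
Unshelve. all: by end_near. Qed.

End moduli_bounds.

Lemma geometric_tail {R : realType} (a : nat -> R) N m :
  (forall k, 0 <= a k) -> (forall k, (N <= k)%N -> a k <= 2^-1 ^+ k) ->
  \sum_(k < m) a k <= \sum_(k < N) a k + 2 * 2^-1 ^+ N.
Proof.
move=> a0 aN; have tail l : \sum_(k < N + l) a k <= \sum_(k < N) a k + 2 * (2^-1 ^+ N - 2^-1 ^+ (N + l)).
  elim: l => [|l IH]; first by rewrite addn0 subrr mulr0 addr0.
  rewrite addnS big_ord_recr /=; have := aN (N + l)%N (leq_addr _ _).
  by rewrite exprSr; lra.
apply: (@le_trans _ _ (\sum_(k < N + m) a k)).
  rewrite (big_ord_widen (N + m) a) ?leq_addl// big_mkcond /=.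
  by apply: ler_sum => i _; case: ifP.
apply: le_trans (tail m) _; rewrite lerD2l ler_pM2l// gerBl; exact: exprn_ge0.
Qed.

(** * Summation of the block maps *)

Section glueing.
Context {R : realType} {V : normedModType R} {X : completeNormedModType R}.
Variables (g : nat * nat -> X) (K : R) (phi : nat -> V -> X) (b : nat -> R).
Hypotheses (K0 : 0 < K) (gK : unconditional_with K g).
Hypothesis phi0 : forall k, phi k 0 = 0.
Hypothesis phi_span : forall k x, span_closure (fun i => g (k, i)) (phi k x).
Hypothesis phi_bounded : forall k x, `|phi k x| <= b k.
Hypothesis phi_unif : forall k (e : R), 0 < e -> exists2 d : R, 0 < d &
  forall x y, `|x - y| <= d -> `|phi k x - phi k y| <= e.
Hypothesis phi_small : forall k x y, `|x - y| <= k%:R -> `|phi k x - phi k y| <= 2^-1 ^+ k.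

(** Since [phi k] vanishes at 0, [phi_small] bounds [phi k x] by [2 ^ -k] as soon as [k] exceeds the
    norm of [x]. *)
Lemma phi_sum_cvg x : cvgn (fun m => \sum_(k < m) phi k x).
Proof.
apply: cvgn_of_cauchy => e e0.
pose N0 := Num.bound `|x|.
have geo : (fun n => 2 * 2^-1 ^+ n) @ \oo --> (0 : R).
  rewrite -(mulr0 2); apply: cvgMl_tmp; apply: cvg_expr.
  by rewrite ger0_norm ?invr_ge0// invf_lt1 ?ltr1n.
have [N1 _ H1] := (cvgrPdist_lt _ _).1 geo _ e0.
exists (maxn N0 N1) => n m; rewrite geq_max => /andP[n0 n1] nm.
have xk k : (n <= k)%N -> `|phi k x| <= 2^-1 ^+ k.
  move=> nk; have := @phi_small k x 0; rewrite phi0 !subr0; apply.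
  apply: ltW; apply: lt_le_trans (archi_boundP (normr_ge0 x)) _.
  by rewrite ler_nat (leq_trans n0).
rewrite distrC -(subnKC nm) big_split_ord /= addrAC subrr add0r.
apply: le_trans (ler_norm_sum _ _ _) _.
pose a k := if (k < n)%N then 0 else `|phi k x|.
have a0 k : 0 <= a k by rewrite /a; case: ifP.
have aN k : (n <= k)%N -> a k <= 2^-1 ^+ k.
  by move=> nk; rewrite /a ltnNge nk /=; exact: xk.
have := geometric_tail (n + (m - n)) a0 aN.
rewrite big_split_ord /= [X in _ <= X + _]big1 => [|i _]; last by rewrite /a ltn_ord.
rewrite [X in X + _ <= _]big1 => [|i _]; last by rewrite /a ltn_ord.
rewrite !add0r => le.
apply: (@le_trans _ _ (2 * 2^-1 ^+ n)).
  apply: le_trans le; apply: ler_sum => i _.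
  by rewrite /a ltnNge leq_addr.
have := H1 n n1; rewrite sub0r normrN => /ltW; apply: le_trans; exact: ler_norm.
Qed.

Definition glue x : X := limn (fun m => \sum_(k < m) phi k x).

Lemma glue_cvg x y :
  (fun m => \sum_(k < m) (phi k x - phi k y)) @ \oo --> glue x - glue y.
Proof. by under eq_fun do rewrite sumrB; apply: cvgB; exact: phi_sum_cvg. Qed.

Lemma glue_dist x y N : `|x - y| <= N%:R ->
  `|glue x - glue y| <= \sum_(k < N) `|phi k x - phi k y| + 2 * 2^-1 ^+ N.
Proof.
move=> xyN; apply: norm_cvgn_le (@glue_cvg x y) _; apply: nearW => m.
apply: le_trans (ler_norm_sum _ _ _) _.
apply: (@geometric_tail R (fun k => `|phi k x - phi k y|)) => // k Nk.
by apply: phi_small; apply: le_trans xyN _; rewrite ler_nat.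
Qed.

Lemma glue_component k x y : `|phi k x - phi k y| <= K * `|glue x - glue y|.
Proof.
apply: (cvgr_to_ge (cvgMl_tmp (cvg_norm (@glue_cvg x y)))).
exists k.+1 => // m /= km.
apply: (@span_closure_component R X g K (fun k => phi k x - phi k y)) => //.
  exact: ltW.
by move=> j; exact: span_closureB.
Qed.

(** Upper estimates come from [glue_dist]: finitely many bounded, uniformly continuous blocks plus a
    geometric tail. Each lower estimate comes from a single block through [glue_component]. *)
Lemma glue_embedding :
  (forall B : R, exists k (t : R), forall x y, t <= `|x - y| -> B <= `|phi k x - phi k y|) ->
  (forall t : R, 0 < t -> exists k, exists2 c : R, 0 < c &
     forall x y, t <= `|x - y| -> c <= `|phi k x - phi k y|) ->
  coarse_embedding glue /\ uniform_embedding glue.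
Proof.
move=> large small; apply: coarse_uniform_embedding.
- move=> t; pose N := Num.bound `|t|.
  have tN : t <= N%:R by apply: le_trans (ler_norm t) _; apply: ltW; exact: archi_boundP.
  exists (\sum_(k < N) (b k + b k) + 2 * 2^-1 ^+ N) => x y xyt.
  apply: le_trans (glue_dist (le_trans xyt tN)) _; rewrite lerD2r.
  by apply: ler_sum => k _; apply: le_trans (ler_normB _ _) _; rewrite lerD.
- move=> e e0.
  have geo : (fun n => 2 * 2^-1 ^+ n) @ \oo --> (0 : R).
    rewrite -(mulr0 2); apply: cvgMl_tmp; apply: cvg_expr.
    by rewrite ger0_norm ?invr_ge0// invf_lt1 ?ltr1n.
  have e2 : 0 < e / 2 by rewrite divr_gt0.
  have [N _ HN] := (cvgrPdist_lt _ _).1 geo _ e2.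
  have {HN} := HN N.+1 (leqnSn N); rewrite sub0r normrN => HN.
  have eN : 0 < e / 2 / N.+1%:R by rewrite divr_gt0.
  have dE k : exists d : R, 0 < d /\ forall x y, `|x - y| <= d ->
      `|phi k x - phi k y| <= e / 2 / N.+1%:R.
    by have [d d0 Hd] := phi_unif k eN; exists d.
  have [d dP] := choice dE.
  (* The cap 1 keeps the distance below [N.+1], as [glue_dist] demands. *)
  pose dmin := \big[Num.min/1]_(k < N.+1) d k.
  exists dmin; first by apply: lt_bigmin => // k _; have [] := dP k.
  move=> x y xy.
  have xyN : `|x - y| <= N.+1%:R.
    apply: le_trans xy _; apply: (@le_trans _ _ 1); first exact: bigmin_le_id.
    by rewrite ler1n.
  apply: le_trans (glue_dist xyN) _.
  have : \sum_(k < N.+1) `|phi k x - phi k y| <= \sum_(k < N.+1) e / 2 / N.+1%:R.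
    apply: ler_sum => k _; have [_] := dP k; apply; apply: le_trans xy _.
    exact: bigmin_le_cond.
  rewrite sumr_const card_ord -[X in _ <= X -> _]mulr_natr divfK ?pnatr_eq0// => le.
  have := le_lt_trans (ler_norm _) HN; lra.
- move=> B; have [k [t Ht]] := large (K * B).
  exists t => x y xyt; rewrite -(ler_pM2l K0).
  exact: le_trans (Ht x y xyt) (glue_component k x y).
- move=> t t0; have [k [c c0 Hc]] := small t t0.
  exists (c / K) => [|x y xyt]; first by rewrite divr_gt0.
  rewrite ler_pdivrMr// mulrC; exact: le_trans (Hc x y xyt) (glue_component k x y).
Qed.

End glueing.

Lemma unconditional_with_scale {R : realType} {X : normedModType R} (T : Type) (K : R)
    (u : T -> X) (r : T -> R) :
  unconditional_with K u -> unconditional_with K (fun t => r t *: u t).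
Proof.
move=> uK I f finj a theta th.
under eq_bigr do rewrite scalerA -mulrA.
under [in leRHS]eq_bigr do rewrite scalerA.
exact: (uK I f finj (fun i => a i * r (f i)) theta th).
Qed.

Lemma unconditional_with_comp {R : realType} {X : normedModType R} (T T' : Type) (K : R)
    (u : T -> X) (p : T' -> T) : injective p ->
  unconditional_with K u -> unconditional_with K (u \o p).
Proof. by move=> pinj uK I f finj; apply: (uK I (p \o f)); exact: inj_comp. Qed.

(** * Amplitudes and scales of the blocks *)

Section tuned_blocks.
Context {R : realType} {X : completeNormedModType R}.
Variables (u : nat -> X) (psi : ell2 R -> X).
Hypothesis psi1 : forall x, `|psi x| <= 1.
Hypothesis psi_span : forall x, span_closure u (psi x).
Hypothesis psi_unif : forall w : R, 0 < w -> exists2 d : R, 0 < d &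
  forall x y, `|x - y| <= d -> `|psi x - psi y| <= w.
Variables (c t : R).
Hypotheses (c0 : 0 < c) (t0 : 0 < t)
  (psi_sep : forall x y, t <= `|x - y| -> c <= `|psi x - psi y|).

(** Subtracting [psi 0] makes the map vanish at 0, which the convergence of the sum relies on. *)
Definition rescaled (l s : R) x : X := l *: (psi (s *: x) - psi 0).

Lemma rescaledB l s x y :
  rescaled l s x - rescaled l s y = l *: (psi (s *: x) - psi (s *: y)).
Proof. by rewrite /rescaled -scalerBr opprB addrA subrK. Qed.

Lemma rescaled_common (l s : R) : 0 < l -> 0 < s -> [/\
  rescaled l s 0 = 0,
  forall x, span_closure u (rescaled l s x),
  forall x, `|rescaled l s x| <= l * 2 &
  forall e : R, 0 < e -> exists2 d : R, 0 < d &
    forall x y, `|x - y| <= d -> `|rescaled l s x - rescaled l s y| <= e].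
Proof.
move=> l0 s0; split.
- by rewrite /rescaled scaler0 subrr scaler0.
- by move=> x; apply: span_closureZ; exact: span_closureB.
- move=> x; rewrite normrZ gtr0_norm// ler_pM2l//.
  by apply: le_trans (ler_normB _ _) _; rewrite -[2]/(1 + 1) lerD.
move=> e e0; have [d d0 H] := psi_unif (divr_gt0 e0 l0).
exists (d / s) => [|x y xy]; first by rewrite divr_gt0.
rewrite rescaledB normrZ gtr0_norm// mulrC -ler_pdivlMr//; apply: H.
by rewrite -scalerBr normrZ gtr0_norm// mulrC -ler_pdivlMr.
Qed.

(** Two values of [psi] differ by at most 2, so the amplitude [2 ^ -k / 2] bounds all oscillation;
    the scale stretches the distance [1 / (n + 1)] to [t]. *)
Lemma rescaled_small k n : exists l s : R, [/\ 0 < l, 0 < s,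
  forall x y, `|rescaled l s x - rescaled l s y| <= 2^-1 ^+ k &
  exists2 c' : R, 0 < c' & forall x y, n.+1%:R^-1 <= `|x - y| ->
    c' <= `|rescaled l s x - rescaled l s y|].
Proof.
have l0 : 0 < 2^-1 ^+ k / 2 :> R by rewrite divr_gt0// exprn_gt0// invr_gt0.
have s0 : 0 < n.+1%:R * t by rewrite mulr_gt0.
exists (2^-1 ^+ k / 2), (n.+1%:R * t); split=> //.
- move=> x y; rewrite rescaledB normrZ gtr0_norm// -ler_pdivlMl// invf_div.
  rewrite divfK ?gt_eqF ?exprn_gt0 ?invr_gt0//.
  by apply: le_trans (ler_normB _ _) _; rewrite -[2]/(1 + 1) lerD.
exists (2^-1 ^+ k / 2 * c) => [|x y xy]; first by rewrite mulr_gt0.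
rewrite rescaledB normrZ gtr0_norm// ler_pM2l//; apply: psi_sep.
by rewrite -scalerBr normrZ gtr0_norm// mulrAC ler_peMl ?(ltW t0)// mulrC -ler_pdivrMr// div1r.
Qed.

(** The amplitude turns the separation [c] into [n + 1]; the scale then shrinks distances up to [k]
    below the [d] at which [psi] moves by at most [2 ^ -k / l]. *)
Lemma rescaled_large k n : exists l s : R, [/\ 0 < l, 0 < s,
  forall x y, `|x - y| <= k%:R -> `|rescaled l s x - rescaled l s y| <= 2^-1 ^+ k &
  exists t' : R, forall x y, t' <= `|x - y| ->
    n%:R <= `|rescaled l s x - rescaled l s y|].
Proof.
pose l := n.+1%:R / c; have l0 : 0 < l by rewrite divr_gt0.
have k0 : 0 < 2^-1 ^+ k :> R by rewrite exprn_gt0// invr_gt0.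
have [d d0 H] := psi_unif (divr_gt0 k0 l0).
pose s := d / k.+1%:R; have s0 : 0 < s by rewrite divr_gt0.
exists l, s; split=> //.
- move=> x y xy; rewrite rescaledB normrZ gtr0_norm// mulrC -ler_pdivlMr//; apply: H.
  rewrite -scalerBr normrZ gtr0_norm// /s mulrAC ler_pdivrMr// ler_pM2l//.
  by apply: le_trans xy _; rewrite ler_nat.
exists (t / s) => x y; rewrite ler_pdivrMr// => xy.
rewrite rescaledB normrZ gtr0_norm//.
apply: (@le_trans _ _ (l * c)); first by rewrite /l divfK ?gt_eqF// ler_nat.
rewrite ler_pM2l//; apply: psi_sep.
by rewrite -scalerBr normrZ gtr0_norm// mulrC.
Qed.

End tuned_blocks.

Theorem theorem1p3 (R : realType) (X : completeNormedModType R) :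
  ~ finite_dimensional X ->
  (exists e : nat -> X, unconditional_basis e) ->
  finite_cotype X ->
  exists f : ell2 R -> X, coarse_embedding f /\ uniform_embedding f.
Proof.
move=> _ [e eU] [q q2 Xq].
have q1 : 1 <= q by apply: le_trans q2; rewrite ler1n.
have [e0 [K K0 eK]] := unconditional_basis_with eU.
(* The injective code of pairs cuts normalised basis vectors into blocks, the first component being
   the block number. *)
pose g (p : nat * nat) : X := `|e (pickle p)|^-1 *: e (pickle p).
have gK : unconditional_with K g.
  apply: (@unconditional_with_comp _ _ _ _ K (fun i => `|e i|^-1 *: e i) pickle).
    exact: (pcan_inj pickleK).
  exact: unconditional_with_scale.
have g1 p : `|g p| = 1.
  by rewrite /g normrZ normfV normr_id mulVf// normr_eq0.
have blockP k : exists phi : ell2 R -> X, [/\ phi 0 = 0,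
    forall x, span_closure (fun i => g (k, i)) (phi x),
    exists B : R, forall x, `|phi x| <= B,
    forall e : R, 0 < e -> exists2 d : R, 0 < d &
      forall x y, `|x - y| <= d -> `|phi x - phi y| <= e &
    [/\ forall x y, `|x - y| <= k%:R -> `|phi x - phi y| <= 2^-1 ^+ k,
       ~~ odd k -> exists2 c : R, 0 < c & forall x y, (k./2).+1%:R^-1 <= `|x - y| ->
         c <= `|phi x - phi y| &
       odd k -> exists t : R, forall x y, t <= `|x - y| -> (k./2)%:R <= `|phi x - phi y|]].
  have uK : unconditional_with K (fun i => g (k, i)).
    by apply: (unconditional_with_comp (p := pair k)) gK => i j [].
  have [psi [psi1 psi_span psi_unif [c c0 [t t0 psi_sep]]]] :=
    block_map q1 K0 uK Xq (fun i => g1 (k, i)).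
  (* Odd blocks serve large distances and even ones small distances; [k./2] runs through all targets
     in either family. *)
  have [ko|ke] := boolP (odd k).
    have [l [s [l0 s0 H1 H2]]] := rescaled_large psi_unif c0 psi_sep k k./2.
    have [r1 r2 r3 r4] := rescaled_common psi1 psi_span psi_unif l0 s0.
    by exists (rescaled psi l s); split=> //; exists (l * 2).
  have [l [s [l0 s0 H1 H2]]] := rescaled_small psi1 c0 t0 psi_sep k k./2.
  have [r1 r2 r3 r4] := rescaled_common psi1 psi_span psi_unif l0 s0.
  by exists (rescaled psi l s); split=> //; exists (l * 2).
have [phi phiP] := choice blockP.
have bE k : exists B : R, forall x, `|phi k x| <= B by have [] := phiP k.
have [b bP] := choice bE.
exists (glue phi); apply: (glue_embedding K0 gK _ _ bP).
- by move=> k; have [] := phiP k.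
- by move=> k; have [] := phiP k.
- by move=> k; have [] := phiP k.
- by move=> k; have [_ _ _ _ []] := phiP k.
- move=> B; pose n := Num.bound `|B|; exists n.*2.+1.
  have [_ _ _ _ [_ _]] := phiP n.*2.+1; rewrite /= odd_double => /(_ isT)[t Ht].
  exists t => x y /Ht; apply: le_trans.
  rewrite uphalf_double; apply: le_trans (ler_norm B) _; apply: ltW; exact: archi_boundP.
- move=> t t0; pose n := Num.bound t^-1; exists n.*2.
  have [_ _ _ _ [_ + _]] := phiP n.*2; rewrite odd_double => /(_ isT)[c c0 Hc].
  exists c => // x y txy; apply: Hc; apply: le_trans txy.
  rewrite doubleK invf_ple ?posrE//; apply: ltW.
  apply: lt_le_trans (archi_boundP _) _; first by rewrite invr_ge0 ltW.
  by rewrite ler_nat.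
Qed.
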